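(* Let $\lambda$ be a partition of $n$. If $\sigma\in\mathrm{RST}(\lambda)$ and $d$ is a divisor of $\sigma$, then $$|\sigma|=\dim\tilde{\mathcal N}_\lambda-\dim\tilde{\mathcal N}_{\lambda/d}+|\sigma/d|.$$
   Context: Young diagrams use the English convention (left-justified rows, row lengths weakly decreasing from top to bottom). $\mathrm{RST}(\lambda)$ is the set of row-strict tableaux of shape $\lambda$: fillings of the Young diagram of $\lambda$ by $1,\dots,n$, each used exactly once, with entries increasing from left to right along each row. For $\sigma\in\mathrm{RST}(\lambda)$, a pair $(i,j)$ with $i>j$ is a Springer inversion of $\sigma$ if (1) $i$ occurs in a box below $j$ and in the same column, or in any column strictly to the left of the column containing $j$, and (2) if the box directly to the right of $j$ is labeled by $r$, then $i<r$. $|\sigma|$ is the number of Springer inversions of $\sigma$. A block in $\sigma$ is a set of consecutive boxes in a single row labeled by consecutive numbers. A positive integer $d$ is a divisor of $\sigma$ if $\sigma$ can be broken up into blocks of size $d$; then $d$ divides every part of $\lambda$. In that case $\lambda/d$ is the partition of $n/d$ obtained by dividing each part of $\lambda$ by $d$, and the quotient tableau $\sigma/d\in\mathrm{RST}(\lambda/d)$ is obtained by merging each block of size $d$ into one box, the block containing $md$ in $\sigma$ becoming the box labeled $m$, $1\le m\le n/d$. $\tilde{\mathcal N}_\lambda$ is the Springer fiber for $SL_n(\mathbb C)$ over a nilpotent matrix of Jordan type $\lambda$ (the variety of Borel subalgebras, or complete flags, fixed by it); $\tilde{\mathcal N}_{\lambda/d}$ is the Springer fiber for $SL_{n/d}(\mathbb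 C)$ over a nilpotent matrix of Jordan type $\lambda/d$. *)

(* Defs.v *)
From HB Require Import structures.
From mathcomp Require Import all_boot all_order all_algebra.
From mathcomp Require Import complex.
From mathcomp Require Import classical_sets boolp reals topology.
From mathcomp Require Import mpoly.

Set Implicit Arguments.
Unset Strict Implicit.
Unset Printing Implicit Defensive.

Import GRing.Theory.

(* Partitions and row-strict tableaux.  A filling is given by its list of     *)
(* rows, from top to bottom; boxes are indexed from 0.                        *)

Definition is_partition (n : nat) (la : seq nat) : bool :=
  [&& sorted geq la, 0 \notin la & sumn la == n].

Definition row_strict_tableau (la : seq nat) (s : seq (seq nat)) : bool :=
  [&& shape s == la,
      perm_eq (flatten s) (iota 1 (sumn la)) & all (sorted ltn) s].

Definition row_of (s : seq (seq nat)) (x : nat) : nat :=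
  find (fun r => x \in r) s.

Definition col_of (s : seq (seq nat)) (x : nat) : nat :=
  index x (nth [::] s (row_of s x)).

Definition right_of (s : seq (seq nat)) (x : nat) : option nat :=
  onth (nth [::] s (row_of s x)) (col_of s x).+1.

Definition springer_inversion (s : seq (seq nat)) (i j : nat) : bool :=
  [&& j < i,
      (col_of s i == col_of s j) && (row_of s j < row_of s i)
        || (col_of s i < col_of s j)
    & if right_of s j is Some r then i < r else true].

Definition num_springer_inversions (s : seq (seq nat)) : nat :=
  count (fun ij => springer_inversion s ij.1 ij.2)
        [seq (i, j) | i <- flatten s, j <- flatten s].

(* The labels of a block of size d, read from left to right. *)
Definition is_block (d : nat) (b : seq nat) : Prop := exists a, b = iota a d.

Definition divisor (d : nat) (s : seq (seq nat)) : Prop :=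
  0 < d /\
  forall r, r \in s ->
    exists bs : seq (seq nat),
      r = flatten bs /\ forall b, b \in bs -> is_block d b.

Definition blocks (d : nat) (r : seq nat) : seq (seq nat) :=
  reshape (nseq (size r %/ d) d) r.

(* d consecutive numbers contain exactly one multiple m * d; m is the label   *)
(* of the merged box.                                                         *)
Definition block_label (d : nat) (b : seq nat) : nat :=
  head 0 [seq x %/ d | x <- b & d %| x].

Definition quotient_tableau (d : nat) (s : seq (seq nat)) : seq (seq nat) :=
  [seq [seq block_label d b | b <- blocks d r] | r <- s].

Definition quotient_partition (d : nat) (la : seq nat) : seq nat :=
  [seq p %/ d | p <- la].

Local Open Scope ring_scope.

(* reshape_index la i is the index of the Jordan block containing row i. *)
Definition jordan_mx (F : fieldType) (n : nat) (la : seq nat) : 'M[F]_n :=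
  \matrix_(i, j)
    ((j == i.+1 :> nat) && (reshape_index la i == reshape_index la j))%:R.

Definition nilpotent_of_type (F : fieldType) (n : nat) (la : seq nat)
    (N : 'M[F]_n) : Prop :=
  is_partition n la /\ N ~_{in unitmx} (jordan_mx F n la).

Definition is_complete_flag (F : fieldType) (n : nat)
    (V : {ffun 'I_n.+1 -> {vspace 'cV[F]_n}}) : bool :=
  [forall i : 'I_n.+1, \dim (V i) == i :> nat] &&
  [forall i : 'I_n.+1, forall j : 'I_n.+1, (i <= j)%N ==> (V i <= V j)%VS].

Record flag (F : fieldType) (n : nat) : Type := Flag {
  flag_val :> {ffun 'I_n.+1 -> {vspace 'cV[F]_n}};
  flag_valP : is_complete_flag flag_val }.

HB.instance Definition _ (F : fieldType) (n : nat) :=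
  [isSub for @flag_val F n].
HB.instance Definition _ (F : fieldType) (n : nat) :=
  [Choice of flag F n by <:].

(* For V a complete flag, this forces g to be invertible; every complete flag *)
(* has such a g, unique up to right multiplication by an invertible upper     *)
(* triangular matrix.                                                         *)
Definition adapted (F : fieldType) (n : nat) (g : 'M[F]_n) (V : flag F n) :
    Prop :=
  forall i : 'I_n.+1, V i = <<[seq col k g | k : 'I_n <- enum 'I_n & (k < i)%N]>>%VS.

Definition mx_eval (F : fieldType) (n : nat) (p : {mpoly F[n * n]})
    (g : 'M[F]_n) : F :=
  p.@[fun k => mxvec g 0 k].

(* The Zariski topology on the flag variety, as the quotient GL_n / B: a set  *)
(* of flags is open if the complement of its preimage in GL_n is the set of   *)
(* common zeros in GL_n of a family of polynomials in the matrix entries      *)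
(* (dividing by powers of the determinant would give the same sets).          *)
Definition zariski_open (F : fieldType) (n : nat) (U : set (flag F n)) : Prop :=
  exists S : set {mpoly F[n * n]},
    forall (g : 'M[F]_n) (V : flag F n), adapted g V ->
      (~ U V <-> forall p, S p -> mx_eval p g = 0).

Lemma zariski_openT (F : fieldType) (n : nat) :
  zariski_open (@setT (flag F n)).
Proof.
exists [set 1]%classic => g V _; split => [/(_ I)//|/(_ 1 erefl)].
by rewrite /mx_eval meval1 => /eqP; rewrite oner_eq0.
Qed.

Lemma zariski_openI (F : fieldType) (n : nat) :
  setI_closed (@zariski_open F n).
Proof.
move=> U U' [S hS] [S' hS'].
exists [set p | exists q q', [/\ S q, S' q' & p = q * q']]%classic => g V gV.
have [{}hS {}hS'] := (hS g V gV, hS' g V gV); split.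
  move=> /not_andP[/hS h _ [q [q' [Sq _ ->]]]|/hS' h _ [q [q' [_ Sq' ->]]]].
    by rewrite /mx_eval mevalM -/(mx_eval q g) h// mul0r.
  by rewrite /mx_eval mevalM -/(mx_eval q' g) h// mulr0.
move=> h [UV UV'].
have /existsNP[q /not_implyP[Sq /eqP q0]] :
  ~ (forall p, S p -> mx_eval p g = 0) by move=> /hS; apply.
have /existsNP[q' /not_implyP[Sq' /eqP q'0]] :
  ~ (forall p, S' p -> mx_eval p g = 0) by move=> /hS'; apply.
have /eqP : mx_eval (q * q') g = 0 by apply: h; exists q, q'.
by rewrite /mx_eval mevalM mulf_eq0 (negPf q0) (negPf q'0).
Qed.

Lemma zariski_open_bigU (F : fieldType) (n : nat) (I : Type)
    (f : I -> set (flag F n)) :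
  (forall i, zariski_open (f i)) -> zariski_open (\bigcup_i f i)%classic.
Proof.
move=> /choice[S hS]; exists (\bigcup_i S i)%classic => g V gV; split.
  move=> h p [i _ Sp]; move: p Sp; apply/(hS i g V gV) => fV.
  by apply: h; exists i.
move=> h [i _ fV]; apply: (iffRL (hS i g V gV)) fV => p Sp.
by apply: h; exists i.
Qed.

HB.instance Definition _ (F : fieldType) (n : nat) :=
  isOpenTopological.Build (flag F n) (@zariski_openT F n)
    (@zariski_openI F n) (@zariski_open_bigU F n).

Local Open Scope classical_set_scope.

Definition irreducible (T : topologicalType) (Z : set T) : Prop :=
  Z !=set0 /\
  forall A B : set T, closed A -> closed B ->
    Z `<=` A `|` B -> Z `<=` A \/ Z `<=` B.

Definition closed_in (T : topologicalType) (X Z : set T) : Prop :=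
  exists2 C : set T, closed C & Z = X `&` C.

Definition irreducible_chain (T : topologicalType) (X : set T) (m : nat) :
    Prop :=
  exists Z : nat -> set T,
    (forall k, (k <= m)%N -> closed_in X (Z k) /\ irreducible (Z k)) /\
    (forall k, (k < m)%N -> Z k `<` Z k.+1).

(* m is the Krull dimension of X for the induced topology; the dimension of   *)
(* an algebraic variety is that of its underlying Zariski space.              *)
Definition has_dim (T : topologicalType) (X : set T) (m : nat) : Prop :=
  irreducible_chain X m /\ forall m', irreducible_chain X m' -> (m' <= m)%N.

Definition springer_fiber (F : fieldType) (n : nat) (N : 'M[F]_n) :
    set (flag F n) :=
  [set V : flag F n | forall (i : 'I_n.+1) (v : 'cV[F]_n), v \in V i -> N *m v \in V i].

(* Main.v *)
Require Import Defs.
From HB Require Import structures.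
From mathcomp Require Import all_boot all_order all_algebra.
From mathcomp Require Import complex.
From mathcomp Require Import classical_sets boolp reals topology.
From mathcomp Require Import mpoly.
From mathcomp Require Import fingroup perm zify.

(** Both Springer fibers have dimension n(la) = sum over the pairs of rows of the
smaller of the two row lengths (pair_min below), and the formula then says that
|s| - |s/d| = n(la) - n(la/d).

The combinatorial half.  Read a tableau as a history: at time i a box is added
to the row of i.  The pairs (i, j) that are Springer inversions correspond to
the pairs (i, r) such that row r, when i is placed, is still longer than the
row of i (or, if r is the higher of the two, at least as long); see
num_springer_inversionsE.  If s breaks up into blocks of size d, the blocks are
the intervals ](m-1)d, md], so s is obtained from q = s/d by replacing each m by
such an interval (divisor_inflate).  While an interval is being placed the other
rows do not move and have lengths divisible by d: the last of the d steps counts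
exactly the inversions of q, and each of the d-1 other steps counts the rows of
q that were strictly longer than the row of m.  Every pair of boxes of q in the
same column is counted once in this way, when the second of them is placed, so
the extra contribution is (d-1) n(la/d) = n(la) - n(la/d).

The geometric half, springer_fiber_dim.  A set of flags is studied through the
set of matrices whose columns are adapted to one of its flags, a union of cosets
of the group B of upper triangular matrices.

Upper bound.  Call W prime if a product of two polynomials can vanish on W only
if one of the factors does.  Going up a strict inclusion of W in a prime W', one
more polynomial joins an algebraically independent family: a polynomial p that
vanishes on W and not on W' (trdeg_geS).  Hence a chain of irreducible closed
subsets of length m in the Springer fiber, started with a chain of subsets of a
single coset of B, gives dim B + m algebraically independent functions on the
frames of the fiber (trdeg_ge_chain).  On the other hand these frames are covered
by the images of finitely many polynomial maps in n(la) + dim B variables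
(covered_stable_frames), and more than k polynomials in k variables are
algebraically dependent (mpoly_dependent).  The parametrization is by induction
on n.  The first line of the flag is spanned by a vector v of the kernel of the
nilpotent matrix N; if a shortest row on which v has a nonzero coordinate has
length l, then v lies in the span of the bottom boxes of the rows of length at
least l, an element of the centralizer of N that is linear in v carries the
bottom box of this row to v, and dividing by the line of v removes one box from
that row.  The number of coordinates of v is exactly what n(la) loses by this
removal, up to the scaling of v, which belongs to B (pair_min_remove).

Lower bound.  The centralizer of N contains a group of matrices that send each
row into itself plus rows that are at least as long.  It is an affine space of
dimension n(la), and its orbit of a suitable flag is an open cell of an
irreducible component of the Springer fiber.  The closures of the images of a complete flag of coordinate
subspaces form the chain that is needed (springer_fiber_chain). *)

Set Implicit Arguments.
Unset Strict Implicit.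
Unset Printing Implicit Defensive.

Import GRing.Theory Num.Theory.

Local Open Scope ring_scope.

(** * Algebraic dependence among polynomials *)

Section Dependence.
Variable F : fieldType.

Lemma mdeg_msuppM n (p q : {mpoly F[n]}) a b :
  (forall m, m \in msupp p -> (mdeg m <= a)%N) ->
  (forall m, m \in msupp q -> (mdeg m <= b)%N) ->
  forall m, m \in msupp (p * q) -> (mdeg m <= a + b)%N.
Proof.
move=> hp hq m /msuppM_le /allpairsP[[m1 m2] /= [m1p m2q ->]].
by rewrite mdegD leq_add ?hp ?hq.
Qed.

Lemma mdeg_msuppX n (p : {mpoly F[n]}) a k :
  (forall m, m \in msupp p -> (mdeg m <= a)%N) ->
  forall m, m \in msupp (p ^+ k) -> (mdeg m <= k * a)%N.
Proof.
move=> hp; elim: k => [|k IH]; last by rewrite exprS mulSn; apply: mdeg_msuppM.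
by move=> m; rewrite expr0 msupp1 inE => /eqP ->; rewrite mdeg0.
Qed.

Lemma mdeg_msupp_prod n I (r : seq I) (p : I -> {mpoly F[n]}) a :
  (forall i m, m \in msupp (p i) -> (mdeg m <= a)%N) ->
  forall m, m \in msupp (\prod_(i <- r) p i) -> (mdeg m <= size r * a)%N.
Proof.
move=> hp; elim: r => [|i r IH].
  by move=> m; rewrite big_nil msupp1 inE => /eqP ->; rewrite mdeg0.
by rewrite big_cons /= mulSn; apply: mdeg_msuppM (hp i) IH.
Qed.

(** Counting: the K ^ M monomials of degree less than K in each of the f i have
exponents bounded by a constant multiple of K, so they lie in a space of
dimension O(K ^ d); for d < M and K large they are linearly dependent. *)
Lemma mpoly_dependent d M (f : 'I_M -> {mpoly F[d]}) : (d < M)%N ->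
  exists2 P : {mpoly F[M]}, P != 0 &
    forall t : 'I_d -> F, P.@[fun i => (f i).@[t]] = 0.
Proof.
move=> ltdM.
pose e := \max_i msize (f i).
(* E bounds the degrees of the products of fewer than K copies of each f i,
   and K is chosen so that E ^ d < K ^ M. *)
pose K := ((M * e).+1 ^ d).+1.
pose E := (M * (K * e)).+1.
pose pr (a : {ffun 'I_M -> 'I_K}) := \prod_i f i ^+ a i.
pose mo m (k : nat) (a : {ffun 'I_m -> 'I_k}) : 'X_{1..m} := [multinom (a i : nat) | i < m].
have mo_inj m k : injective (@mo m k).
  move=> a b /mnmP eq_ab; apply/ffunP => i; apply/val_inj.
  by have := eq_ab i; rewrite !mnmE.
have supp_pr a m : m \in msupp (pr a) -> (mdeg m < E)%N.
  have -> : pr a = \prod_(i <- enum 'I_M) f i ^+ a i by rewrite big_enum; apply: eq_bigl.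
  rewrite ltnS -[in X in (_ <= X * _)%N](size_enum_ord M).
  apply: mdeg_msupp_prod => i m' m'i.
  have fi m1 : m1 \in msupp (f i) -> (mdeg m1 <= e)%N.
    by move=> /msize_mdeg_lt/ltnW/leq_trans; apply; apply: (leq_bigmax i).
  by apply: leq_trans (mdeg_msuppX fi m'i) _; rewrite leq_mul2r (ltnW (ltn_ord _)) orbT.
pose A : 'M[F]_(#|{ffun 'I_M -> 'I_K}|, #|{ffun 'I_d -> 'I_E}|) :=
  \matrix_(a, b) (pr (enum_val a))@_(mo _ _ (enum_val b)).
have exp2r k a b : (a <= b)%N -> (a ^ k <= b ^ k)%N.
  by case: k => // k leab; rewrite leq_exp2r.
have ltcard : (#|{ffun 'I_d -> 'I_E}| < #|{ffun 'I_M -> 'I_K}|)%N.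
  rewrite !card_ffun !card_ord.
  have leE : (E <= K * (M * e).+1)%N by rewrite /E mulnCA mulnS addnC -addn1 leq_add2l.
  apply: (@leq_ltn_trans ((K * (M * e).+1) ^ d)); first exact: exp2r.
  rewrite expnMn; apply: (@leq_trans (K ^ d.+1)); last by rewrite leq_pexp2l.
  by rewrite expnS [in X in (_ < X)%N]mulnC ltn_pmul2l ?expn_gt0.
have [u uA u0] : exists2 u : 'rV_(#|{ffun 'I_M -> 'I_K}|), u *m A = 0 & u != 0.
  have : kermx A != 0.
    rewrite kermx_eq0 -row_leq_rank -ltnNge.
    by apply: leq_ltn_trans (rank_leq_col A) ltcard.
  by case/rowV0Pn => u /sub_kermxP uA u0; exists u.
pose P : {mpoly F[M]} := \sum_a u 0 a *: 'X_[mo _ _ (enum_val a)].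
have Pc a : P@_(mo _ _ (enum_val a)) = u 0 a.
  rewrite raddf_sum (bigD1 a) //= mcoeffZ mcoeffX eqxx mulr1 big1 ?addr0 // => b ba.
  rewrite mcoeffZ mcoeffX (inj_eq (mo_inj _ _)) (inj_eq enum_val_inj).
  by rewrite (negPf ba) mulr0.
exists P.
  apply: contra_neq u0 => P0; apply/rowP => a.
  by rewrite -Pc P0 mcoeff0 mxE.
move=> t; suff PE : \sum_a u 0 a *: pr (enum_val a) = 0.
  transitivity ((\sum_a u 0 a *: pr (enum_val a)).@[t]); last by rewrite PE meval0.
  rewrite /P !raddf_sum /=; apply: eq_bigr => a _.
  rewrite !mevalZ mevalX rmorph_prod; congr (_ * _); apply: eq_bigr => i _.
  by rewrite rmorphXn /= mnmE.
apply/mpolyP => m; rewrite mcoeff0 raddf_sum /=.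
have [lt_mE|le_Em] := ltnP (mdeg m) E; last first.
  rewrite big1 // => a _; rewrite mcoeffZ memN_msupp_eq0 ?mulr0 //.
  by apply: contraL le_Em => /supp_pr; rewrite -ltnNge.
have lt_m i : (m i < E)%N.
  by apply: leq_ltn_trans lt_mE; rewrite mdegE (bigD1 i) //= leq_addr.
have -> : m = mo _ _ [ffun i => Ordinal (lt_m i)].
  by apply/mnmP => i; rewrite mnmE ffunE.
have /rowP/(_ (enum_rank [ffun i => Ordinal (lt_m i)])) := uA.
rewrite !mxE => uA0; apply: etrans uA0; apply: eq_bigr => a _.
by rewrite mcoeffZ mxE enum_rankK.
Qed.

End Dependence.

(** * Transcendence degree of a set of matrices *)

Section MultivariateAsUnivariate.
Variables (F : fieldType) (M : nat).
Implicit Types (P : {mpoly F[M.+1]}).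

Let w := widen_ord (leqnSn M).

Lemma muni_meval P (v : 'I_M.+1 -> F) :
  P.@[v] = (map_poly (meval (fun i => v (w i))) (muni P)).[v ord_max].
Proof.
rewrite muniE [in LHS](mpolyE P) !rmorph_sum /= horner_sum.
apply: eq_bigr => m _.
rewrite mevalZ mevalX -mul_polyC rmorphM /= map_polyC map_polyXn /=.
rewrite hornerM hornerC hornerXn mevalZ mevalX big_ord_recr /= mulrA.
by congr (_ * _ * _); apply: eq_bigr => i _; rewrite mnmE.
Qed.

(** Together with muni_meval, this lets a relation among M + 1 elements be treated
as a polynomial in the last one, with coefficients in the first M. *)
Lemma muni_inj : injective (@muni M F).
Proof.
suff muni_eq0 P : muni P = 0 -> P = 0.
  by move=> P Q /eqP; rewrite -subr_eq0 -muniB => /eqP/muni_eq0/eqP;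
     rewrite subr_eq0 => /eqP.
move=> P0; apply/mpolyP => m; rewrite mcoeff0.
have := congr1 (fun Q : {poly {mpoly F[M]}} =>
  (Q`_(m ord_max))@_[multinom m (w i) | i < M]) P0.
rewrite coef0 mcoeff0 muniE coef_sum raddf_sum /=.
apply: etrans; rewrite [in LHS](mpolyE P) raddf_sum /=; apply: eq_bigr => m' _.
rewrite mcoeffZ mcoeffX coefZ coefXn.
have [<-|m'm] := eqVneq m' m.
  by rewrite !eqxx mulr1 mulr1 mcoeffZ mcoeffX eqxx mulr1.
rewrite mulr0; have [mmax|_] := eqVneq; last by rewrite mulr0 mcoeff0.
rewrite mulr1 mcoeffZ mcoeffX; case: eqP => [mw|_]; last by rewrite mulr0.
case/eqP: m'm; apply/mnmP => i; have [lt_iM|] := ltnP i M.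
  have -> : i = w (Ordinal lt_iM) by apply/val_inj.
  by have /mnmP/(_ (Ordinal lt_iM)) := mw; rewrite !mnmE.
move=> le_Mi; have -> // : i = ord_max.
by apply/val_inj/eqP; rewrite eqn_leq le_Mi -ltnS ltn_ord.
Qed.

End MultivariateAsUnivariate.

Section TranscendenceDegree.
Variables (F : fieldType) (n : nat).
Implicit Types (W : 'M[F]_n -> Prop) (p q : {mpoly F[n * n]}) (g : 'M[F]_n).

(** For a closed W this says that its dimension is at least M. *)
Definition trdeg_ge (M : nat) W : Prop :=
  exists f : 'I_M -> {mpoly F[n * n]},
    forall P : {mpoly F[M]},
      (forall g, W g -> P.@[fun i => mx_eval (f i) g] = 0) -> P = 0.

(** The vanishing ideal of W is prime or is the whole ring. *)
Definition prime_set W : Prop :=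
  forall p q, (forall g, W g -> mx_eval p g * mx_eval q g = 0) ->
    (forall g, W g -> mx_eval p g = 0) \/ (forall g, W g -> mx_eval q g = 0).

Lemma trdeg_ge0 W g : W g -> trdeg_ge 0 W.
Proof.
move=> Wg; exists (fun=> 0) => P /(_ g Wg).
have -> : P = (P@_0)%:MP.
  apply/mpolyP => m; have -> : m = 0%MM by apply/mnmP => -[].
  by rewrite mcoeffC eqxx mulr1.
by rewrite mevalC => ->.
Qed.

Lemma trdeg_ge_sub M W W' :
  (forall g, W g -> W' g) -> trdeg_ge M W -> trdeg_ge M W'.
Proof.
by move=> WW' [f f_indep]; exists f => P PW'; apply: f_indep => g /WW'/PW'.
Qed.

Lemma mx_eval_comp M (P : {mpoly F[M]}) (f : 'I_M -> {mpoly F[n * n]}) g :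
  mx_eval (P \mPo [tuple f i | i < M]) g = P.@[fun i => mx_eval (f i) g].
Proof.
rewrite /mx_eval comp_mpoly_meval; apply: meval_eq => i.
by rewrite tnth_mktuple.
Qed.

(** The new independent element is p.  Given a relation on W' with p as main
variable, its constant term is a relation on W, because p vanishes there, and so
is zero; then p divides the relation on W', and can be cancelled because W' is
prime. *)
Lemma trdeg_geS M W W' p :
  trdeg_ge M W -> (forall g, W g -> W' g) -> prime_set W' ->
  (forall g, W g -> mx_eval p g = 0) ->
  (exists2 g, W' g & mx_eval p g != 0) -> trdeg_ge M.+1 W'.
Proof.
move=> [f f_indep] WW' W'_prime pW [g0 W'g0 pg0].
(* The family f extended by p in the last position. *)
pose f' (i : 'I_M.+1) := if insub (i : nat) is Some j then f j else p.
have f'w (i : 'I_M) : f' (widen_ord (leqnSn M) i) = f i.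
  by rewrite /f' valK.
have f'max : f' ord_max = p by rewrite /f' insubF ?ltnn.
exists f' => P PW'.
pose evm g := meval (fun i => mx_eval (f i) g) : {mpoly F[M]} -> F.
suff main (Q : {poly {mpoly F[M]}}) :
    (forall g, W' g -> (map_poly (evm g) Q).[mx_eval p g] = 0) -> Q = 0.
  apply: muni_inj; rewrite muni0; apply: main => g W'g.
  rewrite -[RHS](PW' g W'g) muni_meval f'max; congr (_.[_]).
  by apply: eq_map_poly => q; apply: meval_eq => i; rewrite f'w.
elim/poly_ind: Q => // Q c IH QW'.
have evE g : (map_poly (evm g) (Q * 'X + c%:P)).[mx_eval p g]
    = (map_poly (evm g) Q).[mx_eval p g] * mx_eval p g + evm g c.
  by rewrite rmorphD rmorphM /= map_polyX map_polyC /= hornerD hornerMX hornerC.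
have c0 : c = 0.
  apply: f_indep => g Wg; have := QW' g (WW' g Wg).
  by rewrite evE pW // mulr0 add0r.
suff Q0 : Q = 0 by rewrite Q0 c0 mul0r addr0.
pose q := (map_poly (comp_mpoly [tuple f i | i < M]) Q).[p].
have qE g : mx_eval q g = (map_poly (evm g) Q).[mx_eval p g].
  rewrite /q /mx_eval -horner_map /= -map_poly_comp; congr (_.[_]).
  by apply: eq_map_poly => r; apply: mx_eval_comp.
apply: IH => g W'g; have [] := W'_prime q p.
- by move=> h W'h; have := QW' h W'h; rewrite evE c0 /evm meval0 addr0 qE.
- by move=> /(_ g W'g); rewrite qE.
- by move=> /(_ g0 W'g0) /eqP; rewrite (negPf pg0).
Qed.

Definition covered (d : nat) W : Prop :=
  exists l : seq 'M[{mpoly F[d]}]_n, forall g, W g ->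
    exists2 Phi, Phi \in l & exists t : 'I_d -> F, g = map_mx (meval t) Phi.

(** On each piece the M functions become M polynomials in d variables.  If d < M
these satisfy a relation, and the product of the relations over the finitely
many pieces is a nonzero relation on W. *)
Lemma trdeg_ge_covered M d W : trdeg_ge M W -> covered d W -> (M <= d)%N.
Proof.
move=> [f f_indep] [l lW]; rewrite leqNgt; apply/negP => ltdM.
suff [P P0 Pl] : exists2 P : {mpoly F[M]}, P != 0 & forall Phi, Phi \in l ->
    forall t, P.@[fun i => mx_eval (f i) (map_mx (meval t) Phi)] = 0.
  case/eqP: P0; apply: f_indep => g /lW[Phi Phil [t ->]]; exact: Pl.
elim: {lW} l => [|Phi l [P P0 Pl]]; first by exists 1; rewrite ?oner_neq0.
pose fPhi i := f i \mPo [tuple mxvec Phi 0 k | k < n * n].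
have [Q Q0 QPhi] := mpoly_dependent fPhi ltdM.
exists (Q * P); first by rewrite mulf_neq0.
move=> Psi; rewrite inE => /orP[/eqP->|Psil] t; rewrite mevalM; last first.
  by rewrite Pl ?mulr0.
suff -> : Q.@[fun i => mx_eval (f i) (map_mx (meval t) Phi)] = 0 by rewrite mul0r.
rewrite -[RHS](QPhi t); apply: meval_eq => i.
rewrite /mx_eval /fPhi comp_mpoly_meval; apply: meval_eq => k.
by rewrite tnth_mktuple -map_mxvec mxE.
Qed.

End TranscendenceDegree.

(** * Affine-linear families of matrices *)

Lemma poly_horner_eq0 (F : numFieldType) (p : {poly F}) :
  (forall s, p.[s] = 0) -> p = 0.
Proof.
move=> p0; apply/eqP; apply: contraT => pn0.
have /(max_poly_roots pn0) : all (root p) [seq i%:R | i <- iota 0 (size p)].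
  by apply/allP => s _; apply/rootP.
rewrite map_inj_uniq ?iota_uniq => [/(_ isT)|i j /eqP].
  by rewrite size_map size_iota ltnn.
by rewrite eqr_nat => /eqP.
Qed.

Section Lines.
Variables (F : numFieldType) (n : nat).
Implicit Types (L : 'M[F]_n -> Prop) (p q : {mpoly F[n * n]}) (g : 'M[F]_n).

(** Over an infinite field these are the affine subspaces, or empty; closure under the line
through two points is all that irreducibility uses. *)
Definition line_closed L : Prop :=
  forall s g g', L g -> L g' -> L (g + s *: (g' - g)).

Lemma mx_eval_line p g g' :
  exists P : {poly F}, forall s, mx_eval p (g + s *: (g' - g)) = P.[s].
Proof.
pose h k := (mxvec g 0 k)%:P + (mxvec (g' - g) 0 k) *: 'X : {poly F}.
exists (mmap polyC h p) => s.
rewrite /mx_eval mevalE /mmap horner_sum; apply: eq_bigr => m _.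
rewrite hornerM hornerC /mmap1 horner_prod; congr (_ * _).
apply: eq_bigr => i _; rewrite horner_exp /h hornerD hornerC hornerZ hornerX.
by rewrite linearD linearZ !mxE mulrC.
Qed.

Lemma det_line g g' :
  exists P : {poly F}, forall s, \det (g + s *: (g' - g)) = P.[s].
Proof.
exists (\det (map_mx polyC g + 'X *: map_mx polyC (g' - g))) => s.
rewrite -horner_evalE -det_map_mx; congr (\det _).
by apply/matrixP => i j; rewrite !mxE /= horner_evalE !hornerE.
Qed.

(** If p is nonzero at g and q at g', then p, q and the determinant restrict to
nonzero polynomials on the line through g and g', so that an infinite line has a
point at which none of the three vanishes. *)
Lemma prime_set_line_closed L :
  line_closed L -> prime_set (fun g => L g /\ g \in unitmx).
Proof.
move=> lineL p q pq0; rewrite -implyNp => /existsNP[g /not_implyP[[Lg ug]]] /eqP pg.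
apply: contrapT => /existsNP[g' /not_implyP[[Lg' ug']]] /eqP qg'.
have [P PE] := mx_eval_line p g g'; have [Q QE] := mx_eval_line q g g'.
have [D DE] := det_line g g'.
have : P * Q * D = 0.
  apply: poly_horner_eq0 => s; rewrite !hornerM -PE -QE -DE.
  have [u|] := boolP (g + s *: (g' - g) \in unitmx).
    by rewrite pq0 ?mul0r //; split=> //; apply: lineL.
  by rewrite unitmxE unitfE negbK => /eqP ->; rewrite mulr0.
move=> /eqP; rewrite !mulf_eq0 => /orP[/orP[]|] /eqP E0.
- by move: pg; have := PE 0; rewrite E0 horner0 scale0r addr0 => ->; rewrite eqxx.
- by move: qg'; have := QE 1; rewrite E0 horner0 scale1r addrC subrK => ->; rewrite eqxx.
- move: ug; have := DE 0; rewrite E0 horner0 scale0r addr0 unitmxE unitfE => ->.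
  by rewrite eqxx.
Qed.

End Lines.

(** * Complete flags and their adapted matrices *)

Lemma col_mulmx (R : pzRingType) m n p (A : 'M[R]_(m, n)) (B : 'M[R]_(n, p)) j :
  col j (A *m B) = A *m col j B.
Proof. by rewrite !colE mulmxA. Qed.

Section Flags.
Variables (F : fieldType) (n : nat).
Implicit Types (g b : 'M[F]_n) (V : flag F n) (v : 'cV[F]_n).

Definition upper_triangular b : Prop := forall i j : 'I_n, (j < i)%N -> b i j = 0.

Definition colspan g (i : nat) : {vspace 'cV[F]_n} :=
  <<[seq col k g | k : 'I_n <- enum 'I_n & (k < i)%N]>>%VS.

Lemma colspan_mem g i (k : 'I_n) : (k < i)%N -> col k g \in colspan g i.
Proof.
move=> lt_ki; apply/memv_span/mapP; exists k => //.
by rewrite mem_filter lt_ki mem_enum.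
Qed.

Lemma colspan_sub g i (U : {vspace 'cV[F]_n}) :
  (forall k : 'I_n, (k < i)%N -> col k g \in U) -> (colspan g i <= U)%VS.
Proof.
move=> gU; apply/span_subvP => v /mapP[k]; rewrite mem_filter => /andP[lt_ki _] ->.
exact: gU.
Qed.

Lemma size_filter_lt_ord i : (i <= n)%N ->
  size [seq k : 'I_n <- enum 'I_n | (k < i)%N] = i.
Proof.
move=> le_in; rewrite -(size_map (@nat_of_ord n)) -[RHS](size_iota 0).
by rewrite -(filter_iota_ltn 0 le_in) -val_enum_ord filter_map.
Qed.

Lemma dim_colspan_le g i : (i <= n)%N -> (\dim (colspan g i) <= i)%N.
Proof.
move=> le_in; apply: leq_trans (dim_span _) _.
by rewrite size_map size_filter_lt_ord.
Qed.

(** In the coordinates given by the columns of g, the flag of g is the standard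
one.  Every later statement on adapted matrices goes through this criterion. *)
Lemma mem_colspan g i v : g \in unitmx ->
  v \in colspan g i <-> forall j : 'I_n, (i <= j)%N -> (invmx g *m v) j 0 = 0.
Proof.
move=> ug; split=> [vg j le_ij|gv0].
  rewrite (coord_span (X := in_tuple _) vg) mulmx_sumr summxE.
  rewrite big1 // => k _; rewrite -scalemxAr mxE.
  have /mapP[l] := mem_nth 0 (ltn_ord k).
  rewrite mem_filter => /andP[lt_li _] ->.
  rewrite -col_mulmx mulVmx // !mxE; case: eqP => [ejl|_]; last by rewrite mulr0.
  by move: le_ij; rewrite ejl leqNgt lt_li.
have -> : v = \sum_j (invmx g *m v) j 0 *: col j g.
  rewrite -[LHS]mul1mx -(mulmxV ug) -mulmxA.
  apply/colP => x; rewrite mxE summxE; apply: eq_bigr => j _.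
  by rewrite !mxE mulrC.
apply: memv_suml => j _; have [le_ij|lt_ji] := leqP i j.
  by rewrite gv0 // scale0r mem0v.
by rewrite memvZ ?colspan_mem.
Qed.

Lemma colspan_lt g (i : 'I_n) : g \in unitmx ->
  (\dim (colspan g i) < \dim (colspan g i.+1))%N.
Proof.
move=> ug; rewrite ltn_neqAle dimvS; last first.
  by apply: colspan_sub => k lt_ki; rewrite colspan_mem // ltnW.
rewrite andbT; apply/negP => /eqP eq_dim.
have : col i g \in colspan g i.
  have /eqP -> : colspan g i == colspan g i.+1.
    rewrite eqEdim eq_dim leqnn andbT.
    by apply: colspan_sub => k lt_ki; rewrite colspan_mem // ltnW.
  by rewrite colspan_mem.
move=> /(mem_colspan _ _ ug)/(_ i (leqnn _))/eqP.
by rewrite -col_mulmx mulVmx // !mxE eqxx oner_eq0.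
Qed.

Lemma dim_colspan g i : g \in unitmx -> (i <= n)%N -> \dim (colspan g i) = i.
Proof.
move=> ug le_in; apply/eqP; rewrite eqn_leq dim_colspan_le //=.
elim: i le_in => // i IH lt_in; apply: leq_ltn_trans (colspan_lt (Ordinal lt_in) ug).
exact: IH (ltnW lt_in).
Qed.

Lemma flag_dim V (i : 'I_n.+1) : \dim (V i) = i.
Proof. by case/andP: (flag_valP V) => /forallP/(_ i)/eqP. Qed.

Lemma flag_subv V (i j : 'I_n.+1) : (i <= j)%N -> (V i <= V j)%VS.
Proof. by case/andP: (flag_valP V) => _ /forallP/(_ i)/forallP/(_ j)/implyP. Qed.

Lemma adapted_unitmx g V : adapted g V -> g \in unitmx.
Proof.
move=> gV; have Vmax : colspan g n = fullv.
  have dim_n : \dim (colspan g n) = n by rewrite -[RHS](flag_dim V ord_max) gV.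
  by apply/eqP; rewrite eqEdim subvf dim_n dimvf /dim /= muln1.
have /fin_all_exists[u gu] (j : 'I_n) : exists u, col j 1%:M = g *m u :> 'cV[F]_n.
  have : col j 1%:M \in colspan g n by rewrite Vmax memvf.
  have /subvP sub : (colspan g n <= linfun (mulmx g : 'cV_n -> 'cV_n) @: fullv)%VS.
    apply: colspan_sub => k _; apply/memv_imgP; exists (delta_mx k 0).
      exact: memvf.
    by rewrite lfunE /= -colE.
  by move=> /sub/memv_imgP[u _ ->]; exists u; rewrite lfunE.
have : g *m (\matrix_(x, j) u j x 0) = 1%:M.
  by apply/matrixP => x j; move/colP/(_ x): (gu j); rewrite !mxE => ->;
     apply: eq_bigr => k _; rewrite mxE.
by move=> /mulmx1_unit[].
Qed.

Lemma exists_adapted V : exists g, adapted g V.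
Proof.
have /fin_all_exists[v vV] (i : 'I_n) :
    exists v, (v \in V (lift ord0 i)) && (v \notin V (widen_ord (leqnSn n) i)).
  have : ~~ (V (lift ord0 i) <= V (widen_ord (leqnSn n) i))%VS.
    by apply/negP => /dimvS; rewrite !flag_dim /= ltnn.
  by move=> /subvPn[v v1 v2]; exists v; rewrite v1.
pose g := \matrix_(x, i) v i x 0.
have colg i : col i g = v i by apply/colP => x; rewrite !mxE.
exists g; case; elim=> [|i IH] lt_i; rewrite -/(colspan _ _).
  have /eqP : \dim (V (Ordinal lt_i)) = 0 by rewrite flag_dim.
  rewrite dimv_eq0 => /eqP ->; apply/esym/eqP; rewrite -subv0.
  exact: colspan_sub.
pose j : 'I_n := Ordinal (lt_i : i < n)%N.
have [] := andP (vV j).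
have -> : lift ord0 j = Ordinal lt_i by apply/val_inj.
have -> : widen_ord (leqnSn n) j = Ordinal (ltnW lt_i) by apply/val_inj.
move=> vj vj'; apply/esym/eqP; rewrite eqEdim flag_dim /=; apply/andP; split.
  apply: colspan_sub => k lt_ki; rewrite colg.
  by apply: (subvP (flag_subv V _)) (proj1 (andP (vV k))).
have sub : (colspan g i <= colspan g i.+1)%VS.
  by apply: colspan_sub => k lt_ki; rewrite colspan_mem // ltnW.
have gi : V (Ordinal (ltnW lt_i)) = colspan g i := IH _.
have dim_i : \dim (colspan g i) = i by rewrite -gi flag_dim.
apply: (@leq_ltn_trans (\dim (colspan g i))); first by rewrite dim_i.
rewrite ltn_neqAle dimvS // andbT; apply: contra vj' => /eqP eq_dim.
rewrite gi; have /eqP -> : colspan g i == colspan g i.+1 by rewrite eqEdim sub eq_dim /=.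
by rewrite -colg colspan_mem.
Qed.

Lemma exists_flag g : g \in unitmx -> exists V, adapted g V.
Proof.
move=> ug; have flagP : is_complete_flag [ffun i : 'I_n.+1 => colspan g i].
  apply/andP; split; apply/forallP => i.
    by rewrite ffunE dim_colspan // -ltnS.
  apply/forallP => j; apply/implyP => le_ij; rewrite !ffunE.
  by apply: colspan_sub => k lt_ki; rewrite colspan_mem // (leq_trans lt_ki).
by exists (Flag flagP) => i; rewrite /= ffunE.
Qed.

Lemma adapted_mulr g b V :
  adapted g V -> upper_triangular b -> b \in unitmx -> adapted (g *m b) V.
Proof.
move=> gV tb ub i; have ug := adapted_unitmx gV.
apply/esym/eqP; rewrite eqEdim -/(colspan _ _) flag_dim dim_colspan ?unitmx_mul ?ug -1?ltnS //.
rewrite leqnn andbT gV -/(colspan g i); apply: colspan_sub => k lt_ki.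
apply/(mem_colspan _ _ ug) => j le_ij.
by rewrite -col_mulmx mulmxA mulVmx // mul1mx mxE tb // (leq_trans lt_ki).
Qed.

Lemma adapted_upper g g' V :
  adapted g V -> adapted g' V -> upper_triangular (invmx g *m g').
Proof.
move=> gV g'V i j lt_ji; have ug := adapted_unitmx gV.
have : col j g' \in V (lift ord0 j) by rewrite g'V (colspan_mem g' (i := j.+1)).
by rewrite gV -/(colspan _ _) => /(mem_colspan _ _ ug)/(_ i lt_ji); rewrite -col_mulmx mxE.
Qed.

Lemma springer_adapted (N : 'M[F]_n) g V : adapted g V ->
  springer_fiber N V <-> upper_triangular (invmx g *m N *m g).
Proof.
move=> gV; have ug := adapted_unitmx gV; split=> [NV i j lt_ji|tN i v].
  have : N *m col j g \in V (lift ord0 j).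
    by apply: NV; rewrite gV (colspan_mem g (i := j.+1)).
  rewrite gV -/(colspan _ _) => /(mem_colspan _ _ ug)/(_ i lt_ji).
  by rewrite mulmxA -col_mulmx mxE.
rewrite gV -/(colspan g i) => /(mem_colspan _ _ ug) vi.
apply/(mem_colspan _ _ ug) => j le_ij.
have -> : invmx g *m (N *m v) = (invmx g *m N *m g) *m (invmx g *m v).
  by rewrite !mulmxA mulmxK.
rewrite mxE big1 // => k _; have [le_ik|lt_ki] := leqP i k.
  by rewrite vi ?mulr0.
by rewrite tN ?mul0r // (leq_trans lt_ki).
Qed.

End Flags.

(** * Closed and irreducible sets of flags *)

(** The inverse image of Z under the projection of GL_n onto the flag variety. *)
Definition frames (F : fieldType) (n : nat) (Z : set (flag F n)) (g : 'M[F]_n) : Prop :=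
  exists2 V, Z V & adapted g V.

Section ZariskiTopology.
Variables (F : numFieldType) (n : nat).
Implicit Types (b : 'M[F]_n) (p q : {mpoly F[n * n]}) (Z C : set (flag F n)) (g : 'M[F]_n).
Local Open Scope classical_set_scope.

Lemma flag_closedP C : closed C <->
  exists S : set {mpoly F[n * n]}, forall g V, adapted g V ->
    (C V <-> forall p, S p -> mx_eval p g = 0).
Proof.
have CE V : (~ (~` C) V) = C V by rewrite -[RHS]notK.
rewrite -openC; split=> [[S hS]|[S hS]]; exists S => g V gV; have := hS g V gV;
  by rewrite CE.
Qed.

(** The zero set of p is not a union of cosets of B in general; this is the largest
set of flags whose frames all lie in it. *)
Definition vanishing_locus p : set (flag F n) :=
  [set V | forall g, adapted g V -> mx_eval p g = 0].

Lemma mx_eval_coord (g : 'M[F]_n) i j : mx_eval 'X_(mxvec_index i j) g = g i j.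
Proof. by rewrite /mx_eval mevalXU mxvecE. Qed.

Lemma mx_eval_mulmx p (a b : 'M[F]_n) :
  exists q, forall g, mx_eval q g = mx_eval p (a *m g *m b).
Proof.
pose X : 'M[{mpoly F[n * n]}]_n := \matrix_(i, j) 'X_(mxvec_index i j).
pose aXb := map_mx (@mpolyC _ F) a *m X *m map_mx (@mpolyC _ F) b.
exists (p \mPo [tuple mxvec aXb 0 k | k < n * n]) => g.
rewrite /mx_eval comp_mpoly_meval; apply: meval_eq => k.
pose ev := meval (fun k => mxvec g 0 k).
rewrite tnth_mktuple; have -> : a *m g *m b = map_mx ev aXb.
  have evC c : map_mx ev (map_mx (@mpolyC _ F) c) = c :> 'M_n.
    by apply/matrixP => i j; rewrite !mxE /ev mevalC.
  rewrite !map_mxM !evC; congr (_ *m _ *m _).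
  by apply/matrixP => i j; rewrite !mxE -mx_eval_coord.
by rewrite -map_mxvec mxE.
Qed.

(** The equations in g are the p (g * b), with b running through the invertible
upper triangular matrices. *)
Lemma closed_vanishing_locus p : closed (vanishing_locus p).
Proof.
apply/flag_closedP.
exists [set q | exists b, [/\ upper_triangular b, b \in unitmx &
  forall g, mx_eval q g = mx_eval p (g *m b)]] => g V gV; split.
  by move=> pV q [b [tb ub qE]]; rewrite qE pV //; apply: adapted_mulr.
move=> pV g' g'V; have ug := adapted_unitmx gV; have ug' := adapted_unitmx g'V.
have [q qE] := mx_eval_mulmx p 1%:M (invmx g *m g').
have -> : g' = 1%:M *m g *m (invmx g *m g') by rewrite mul1mx mulKVmx.
rewrite -qE; apply: pV; exists (invmx g *m g'); split=> //.
- exact: adapted_upper gV g'V.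
- by rewrite unitmx_mul unitmx_inv ug.
- by move=> h; rewrite qE mul1mx.
Qed.

Lemma adaptedP g g' V : adapted g V ->
  adapted g' V <-> upper_triangular (invmx g *m g') /\ g' \in unitmx.
Proof.
move=> gV; have ug := adapted_unitmx gV; split=> [g'V|[tg' ug']].
  by split; [apply: adapted_upper gV g'V | apply: adapted_unitmx g'V].
rewrite -[g'](mulKVmx ug); apply: adapted_mulr => //.
by rewrite unitmx_mul unitmx_inv ug.
Qed.

(** The frames of a single flag form the invertible part of a linear space, so if
p * q vanishes on them, p or q does; thus Z is covered by the vanishing loci of p
and q. *)
Lemma prime_set_frames Z : irreducible Z -> prime_set (frames Z).
Proof.
move=> [_ Zirr] p q pq0.
have [] := Zirr _ _ (@closed_vanishing_locus p) (@closed_vanishing_locus q).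
- move=> V ZV; have [g gV] := exists_adapted V.
  have lineL : line_closed (fun h => upper_triangular (invmx g *m h)).
    move=> s h h' th th' i j lt_ji.
    rewrite mulmxDr -scalemxAr mulmxBr !mxE.
    have := th i j lt_ji; have := th' i j lt_ji; rewrite !mxE => -> ->.
    by rewrite subrr mulr0 addr0.
  have := prime_set_line_closed lineL (p := p) (q := q).
  case=> [h /(adaptedP _ gV) hV|pV|qV]; first by apply: pq0; exists V.
    by left=> h hV; apply: pV; apply/(adaptedP _ gV).
  by right=> h hV; apply: qV; apply/(adaptedP _ gV).
- by move=> pV; left=> g [V ZV gV]; apply: (pV V ZV).
- by move=> qV; right=> g [V ZV gV]; apply: (qV V ZV).
Qed.

Lemma upper_triangular_unitmx (b : 'M[F]_n) : upper_triangular b ->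
  (forall i, b i i != 0) -> b \in unitmx.
Proof.
move=> tb b0; rewrite -unitmx_tr unitmxE det_trig.
  by rewrite unitfE; apply/prodf_neq0 => i _; rewrite mxE.
by apply/is_trig_mxP => i j lt_ij; rewrite mxE tb.
Qed.

Lemma card_upper : #|[pred ji : 'I_n * 'I_n | (ji.2 <= ji.1)%N]| = (\sum_(j < n) j.+1)%N.
Proof.
rewrite -sum1_card -(pair_big_dep xpredT (fun j i : 'I_n => i <= j)%N (fun _ _ => 1%N)) /=.
apply: eq_bigr => j _.
rewrite -[RHS](size_filter_lt_ord (ltn_ord j)) -sum1_size big_filter big_enum_cond.
exact: eq_bigl.
Qed.

(** The coset of B is built up one entry of the upper triangle at a time: the entry
to be released is a polynomial that vanishes before the release and not after.
The sum is the dimension of B. *)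
Lemma trdeg_ge_fiber V : trdeg_ge (\sum_(j < n) j.+1)%N (fun g => adapted g V).
Proof.
have [g gV] := exists_adapted V; have ug := adapted_unitmx gV.
rewrite -card_upper cardE; set ps := enum _.
pose L k h := upper_triangular (invmx g *m h) /\
  forall ji, ji \in drop k ps -> (invmx g *m h) ji.2 ji.1 = (ji.2 == ji.1)%:R.
suff main k : (k <= size ps)%N -> trdeg_ge k (fun h => L k h /\ h \in unitmx).
  by apply: trdeg_ge_sub (main _ (leqnn _)) => h [[th _] uh]; apply/(adaptedP _ gV).
elim: k => [|k IH] lt_k.
  apply: (@trdeg_ge0 _ _ _ g); split=> //; split; rewrite mulVmx //.
    by move=> i j lt_ji; rewrite mxE -(inj_eq val_inj) gtn_eqF.
  by move=> ji _; rewrite mxE.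
case ji0E : (tnth (in_tuple ps) (Ordinal lt_k)) => [j0 i0].
have nth_k : nth (j0, i0) ps k = (j0, i0) by rewrite -{2}ji0E (tnth_nth (j0, i0)).
have dropE : drop k ps = (j0, i0) :: drop k.+1 ps by rewrite (drop_nth (j0, i0)) // nth_k.
have le_ij : (i0 <= j0)%N.
  have : (j0, i0) \in ps by rewrite -nth_k mem_nth.
  by rewrite mem_enum.
have notin_drop : (j0, i0) \notin drop k.+1 ps.
  by have := drop_uniq k (enum_uniq _ : uniq ps); rewrite dropE => /andP[].
have [q qE] := mx_eval_mulmx 'X_(mxvec_index i0 j0) (invmx g) 1%:M.
have coordE h : mx_eval (q - ((i0 == j0)%:R)%:MP) h = (invmx g *m h) i0 j0 - (i0 == j0)%:R.
  by rewrite /mx_eval mevalB mevalC -/(mx_eval _ _) qE mx_eval_coord mulmx1.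
apply: (trdeg_geS (IH (ltnW lt_k)) (p := q - ((i0 == j0)%:R)%:MP)).
- move=> h [[th hk] uh]; split=> //; split=> // ji ji_in; apply: hk.
  by rewrite dropE inE ji_in orbT.
- apply: prime_set_line_closed => s h h' [th hk] [th' hk'].
  rewrite /L mulmxDr -scalemxAr mulmxBr; split=> [i j lt_ji|ji ji_in].
    by have := th i j lt_ji; have := th' i j lt_ji; rewrite !mxE => -> ->;
       rewrite subrr mulr0 addr0.
  by have := hk ji ji_in; have := hk' ji ji_in; rewrite !mxE => -> ->;
     rewrite subrr mulr0 addr0.
- move=> h [[th hk] uh]; rewrite coordE (hk (j0, i0)) ?subrr //.
  by rewrite dropE inE eqxx.
(* When i0 = j0 this diagonal entry is 2, so b is invertible in every case. *)
pose b : 'M[F]_n := 1%:M + delta_mx i0 j0.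
have tb : upper_triangular b.
  move=> i j lt_ji; rewrite !mxE -(inj_eq val_inj) gtn_eqF //=.
  have [ei|_] := eqVneq i i0; last by rewrite addr0.
  have [ej|_] := eqVneq j j0; last by rewrite addr0.
  by rewrite ei ej ltnNge le_ij in lt_ji.
have ub : b \in unitmx.
  apply: upper_triangular_unitmx => // i; rewrite !mxE eqxx.
  by rewrite -natrD pnatr_eq0.
exists (g *m b); last first.
  by rewrite coordE mulKmx // !mxE !eqxx addrAC subrr add0r oner_eq0.
split; last by rewrite unitmx_mul ug.
rewrite /L mulKmx //; split=> // -[j i] ji_in /=; rewrite !mxE.
have [/= Ei|] := eqVneq i i0; last by rewrite addr0.
have [/= Ej|] := eqVneq j j0; last by rewrite addr0.
by rewrite -Ei -Ej ji_in in notin_drop.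
Qed.

(** A flag of Z k.+1 outside Z k is separated from Z k by one of the equations of
Z k, which is the polynomial that trdeg_geS asks for. *)
Lemma trdeg_ge_chain (X : set (flag F n)) m : irreducible_chain X m ->
  trdeg_ge (\sum_(j < n) j.+1 + m)%N (frames X).
Proof.
move=> [Z [Zirr Zlt]].
have ZX k : (k <= m)%N -> Z k `<=` X.
  by move=> /Zirr[[C _ ->] _]; apply: subIsetl.
suff main k : (k <= m)%N -> trdeg_ge (\sum_(j < n) j.+1 + k)%N (frames (Z k)).
  by apply: trdeg_ge_sub (main _ (leqnn _)) => g [V /ZX XV gV]; exists V; auto.
elim: k => [|k IH] lt_km.
  have [_ [[V ZV] _]] := Zirr 0 lt_km.
  by rewrite addn0; apply: trdeg_ge_sub (trdeg_ge_fiber V) => g gV; exists V.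
have [[C Ccl ZC] _] := Zirr k (ltnW lt_km); have [_ Z'irr] := Zirr k.+1 lt_km.
have [subZ /existsNP[V /not_implyP[ZV nZV]]] := Zlt k lt_km.
have /flag_closedP[S SC] := Ccl.
have [g gV] := exists_adapted V.
have nCV : ~ C V by move=> CV; apply: nZV; rewrite ZC; split=> //; apply: ZX ZV.
have /existsNP[p /not_implyP[Sp /eqP pg]] :
  ~ (forall p, S p -> mx_eval p g = 0) by move=> /(SC g V gV).
rewrite addnS; apply: (trdeg_geS (IH (ltnW lt_km)) (p := p)).
- by move=> h [U /subZ]; exists U.
- exact: prime_set_frames.
- by move=> h [U]; rewrite ZC => -[_ CU] hU; apply: (iffLR (SC h U hU)) CU _ Sp.
- by exists g => //; exists V.
Qed.

End ZariskiTopology.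

(** * Polynomial parametrizations and labeled Young diagrams *)

Section Covering.
Variable F : fieldType.

Lemma covered_bigcup n d (I : finType) (W : I -> 'M[F]_n -> Prop) :
  (forall i, covered d (W i)) -> covered d (fun g => exists i, W i g).
Proof.
move=> /fin_all_exists[l lW]; exists (flatten [seq l i | i <- enum I]) => g [i Wig].
have [Phi Phil Phit] := lW i g Wig; exists Phi => //.
by apply/flatten_mapP; exists i => //; rewrite mem_enum.
Qed.

Lemma covered_sub n d (W W' : 'M[F]_n -> Prop) :
  (forall g, W g -> W' g) -> covered d W' -> covered d W.
Proof. by move=> WW' [l lW']; exists l => g /WW'/lW'. Qed.

Lemma covered_mull n d (W : 'M[F]_n -> Prop) a : a \in unitmx ->
  covered d W -> covered d (fun g => W (a *m g)).
Proof.
move=> ua [l lW]; exists [seq map_mx (@mpolyC d F) (invmx a) *m Phi | Phi <- l] => g.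
move=> /lW[Phi Phil [t agt]]; exists (map_mx (@mpolyC d F) (invmx a) *m Phi).
  exact: map_f.
exists t; rewrite map_mxM -agt -[LHS](mulKmx ua); congr (_ *m _).
by move: (invmx a) => b; apply/matrixP => i j; rewrite !mxE /= mevalC.
Qed.

End Covering.

(** The basis vectors are labeled bijectively by the boxes (row, column) of the
diagram with R rows of lengths len 0, ..., len R.-1.  The lengths are not assumed
to be decreasing, so that a box can be removed from any row. *)
Definition diagram_labeling (R : nat) (len : nat -> nat) n (c : 'I_n -> nat * nat) : Prop :=
  injective c /\ forall r a, (exists z, c z = (r, a)) <-> (r < R)%N /\ (a < len r)%N.

(** The nilpotent matrix that moves each box one step to the left and kills the
boxes of column 0, which span its kernel. *)
Definition shift_mx (F : fieldType) n (c : 'I_n -> nat * nat) : 'M[F]_n :=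
  \matrix_(i, j) (c j == ((c i).1, (c i).2.+1))%:R.

(** For decreasing lengths this is the usual statistic n(la), the sum of r * la_r.
The symmetric form also makes sense for lengths in any order. *)
Definition pair_min (R : nat) (len : nat -> nat) : nat :=
  \sum_(r < R) \sum_(r' < r) minn (len r') (len r).

Lemma sum_ord_eq m k (b : bool) :
  (\sum_(i < m) ((i == k :> nat) && b) = (k < m)%N && b)%N.
Proof. by elim: m => [|m IH]; rewrite ?big_ord0 // big_ord_recr /= IH; lia. Qed.

(** Shortening row r0 by one box lowers its minimum with each other row of length
at least len r0 and changes nothing else; the count includes r0 itself, whence
the successor. *)
Lemma pair_min_remove R len r0 : (r0 < R)%N -> (0 < len r0)%N ->
  (pair_min R len).+1 = (count (fun r => len r0 <= len r) (iota 0 R) +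
    pair_min R (fun r => if r == r0 then (len r).-1 else len r))%N.
Proof.
move=> lt_r0R len0; pose len' r := if r == r0 then (len r).-1 else len r; rewrite -/len'.
pose ge r := (len r0 <= len r)%N.
(* What the minimum of the lengths of rows r and r' loses. *)
pose lost r r' := (((r == r0) && ge r') + ((r' == r0) && ge r))%N.
have minE r r' : r' != r -> minn (len r') (len r) = (minn (len' r') (len' r) + lost r r')%N.
  rewrite /len' /lost /ge => ner; case: (eqVneq r r0) ner => [->|_] ner.
    by move: len0; rewrite (negPf ner) /=; lia.
  by case: (eqVneq r' r0) => [->|_]; move: len0 => /=; lia.
have -> : pair_min R len = (pair_min R len' + \sum_(r < R) \sum_(r' < r) lost r r')%N.
  rewrite -big_split; apply: eq_bigr => r _; rewrite -big_split.
  by apply: eq_bigr => r' _; rewrite minE // ltn_eqF.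
have countS m : count ge (iota 0 m.+1) = (count ge (iota 0 m) + ge m)%N.
  by rewrite -addn1 iotaD count_cat /= addn0.
have sum_count m : (\sum_(i < m) ge i = count ge (iota 0 m))%N.
  by elim: m => [|m IH]; rewrite ?big_ord0 // countS big_ord_recr IH.
(* By induction on the number of rows; the correction (r0 < m) is the term r0
   of the count. *)
have lostE m : (\sum_(r < m) \sum_(r' < r) lost r r' + (r0 < m) = (r0 < m) * count ge (iota 0 m))%N.
  elim: m => [|m IH]; first by rewrite big_ord0.
  rewrite countS big_ord_recr /= big_split /= sum_ord_eq.
  have -> : (\sum_(i < m) ((m == r0) && ge i) = (m == r0) * count ge (iota 0 m))%N.
    by case: (m == r0); rewrite /= ?sum_count ?mul1n // big1.
  have ge_r0 : ge r0 by rewrite /ge.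
  by case: (eqVneq m r0) IH => [->|ne_m] /=; rewrite ?ge_r0; lia.
by have := lostE R; rewrite lt_r0R -/ge; lia.
Qed.

(** * Matrices commuting with a nilpotent shift *)

Section MoveFirstColumn.
Variables (A : comNzRingType) (n : nat) (c : 'I_n -> nat * nat) (p : 'I_n).
Implicit Types (V : nat -> A).

(** Replaces each box of the row of p by the combination, with coefficients V r, of
the boxes of the same column in all rows r.  The coefficients lie in a ring so
that they may be indeterminates. *)
Definition row_mix_mx V : 'M[A]_n := \matrix_(z, y)
  if (c y).1 == (c p).1 then (if (c z).2 == (c y).2 then V (c z).1 else 0)
  else (z == y)%:R.

(** Replacing a row by an invertible combination of it with other rows is an
elementary operation, undone by solving for the original row. *)
Lemma row_mix_mx_inv V V' : injective c ->
  V (c p).1 * V' (c p).1 = 1 ->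
  (forall r, r != (c p).1 -> V' r = - (V' (c p).1 * V r)) ->
  row_mix_mx V *m row_mix_mx V' = 1%:M.
Proof.
move=> c_inj Vp V'r; apply/matrixP => z y; rewrite !mxE.
have [ey|ny] := eqVneq (c y).1 (c p).1; last first.
  rewrite (bigD1 y) //= !mxE !eqxx (negPf ny) /= mulr1 big1 ?addr0 // => x xy.
  by rewrite !mxE (negPf ny) /= (negPf xy) mulr0.
rewrite (bigD1 y) //= !mxE ey !eqxx.
have E x : x != y -> row_mix_mx V z x * row_mix_mx V' x y =
    if (x == z) && (((c z).2 == (c y).2) && ((c z).1 != (c p).1)) then V' (c z).1 else 0.
  move=> xy; rewrite !mxE ey eqxx; have [e2|n2] := eqVneq (c x).2 (c y).2; last first.
    by rewrite /= mulr0; case: eqP => //= <-; rewrite (negPf n2).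
  have n1 : (c x).1 != (c p).1.
    apply: contra xy => /eqP e1; apply/eqP/c_inj.
    by rewrite [c x]surjective_pairing [c y]surjective_pairing e1 e2 ey.
  rewrite (negPf n1) /= [z == x]eq_sym; case: eqP => [<-|_] /=; last by rewrite mul0r.
  by rewrite e2 eqxx n1 mul1r.
rewrite (eq_bigr _ E).
have [Ezy|zy] := eqVneq z y.
  rewrite big1 => [|x /negPf xy]; last by rewrite Ezy xy.
  by rewrite -{1}Ezy eqxx addr0 Ezy ey Vp.
rewrite (bigD1 z) //= eqxx big1 ?addr0 => [|x /andP[_ /negPf ->]] //.
have [e2|_] := eqVneq (c z).2 (c y).2; last by rewrite mul0r addr0.
have [e1|n1] /= := eqVneq (c z).1 (c p).1; last first.
  by rewrite (V'r (c z).1) // mulrC subrr.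
by case/eqP: zy; apply: c_inj;
   rewrite [c z]surjective_pairing [c y]surjective_pairing e1 e2 ey.
Qed.

End MoveFirstColumn.

Lemma row_mix_mx_unit (F : fieldType) n (c : 'I_n -> nat * nat) p (V : nat -> F) :
  injective c -> V (c p).1 != 0 -> row_mix_mx c p V \in unitmx.
Proof.
move=> c_inj V0.
pose V' r := if r == (c p).1 then (V (c p).1)^-1 else - ((V (c p).1)^-1 * V r).
have /mulmx1_unit[] // : row_mix_mx c p V *m row_mix_mx c p V' = 1%:M.
apply: row_mix_mx_inv => // [|r rp]; first by rewrite /V' eqxx mulfV.
by rewrite /V' eqxx (negPf rp).
Qed.

Section ShiftMatrix.
Variables (F : fieldType) (R : nat) (len : nat -> nat) (n : nat) (c : 'I_n -> nat * nat).
Hypothesis c_lab : diagram_labeling R len c.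

Lemma labeling_below j a : (c j).2 = a.+1 -> exists i, c i = ((c j).1, a).
Proof.
move=> ja; have [_ lab] := c_lab.
have /(lab _ _)[lt_R lt_len] : exists z, c z = ((c j).1, a.+1).
  by exists j; rewrite -ja -surjective_pairing.
by apply/lab; split=> //; apply: ltnW.
Qed.

Lemma labeling_eq i j : c i = c j -> i = j.
Proof. exact: (proj1 c_lab). Qed.

Lemma labeling_pair i j : (c i).1 = (c j).1 -> (c i).2 = (c j).2 -> i = j.
Proof.
by move=> e1 e2; apply: labeling_eq; rewrite [c i]surjective_pairing e1 e2 -surjective_pairing.
Qed.

(** Multiplication by the shift moves the rows of M on one side and its columns on
the other; the last two hypotheses deal with the boxes at the ends of the rows,
where one of the two moves falls off the diagram. *)
Lemma shift_mx_comm (M : 'M[F]_n) :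
  (forall w w' y y', c w' = ((c w).1, (c w).2.+1) -> c y = ((c y').1, (c y').2.+1) ->
     M w' y = M w y') ->
  (forall w y, (0 < (c w).2)%N -> (c y).2 = 0%N -> M w y = 0) ->
  (forall w y y', (forall w', c w' <> ((c w).1, (c w).2.+1)) ->
     c y = ((c y').1, (c y').2.+1) -> M w y' = 0) ->
  shift_mx F c *m M = M *m shift_mx F c.
Proof.
move=> M_shift M_bottom M_top; apply/matrixP => w y; rewrite !mxE.
have JE i j : shift_mx F c i j = (c j == ((c i).1, (c i).2.+1))%:R by rewrite mxE.
have row_J z : c z = ((c w).1, (c w).2.+1) -> \sum_k shift_mx F c w k * M k y = M z y.
  move=> cz; rewrite (bigD1 z) //= JE cz eqxx mul1r big1 ?addr0 // => k kz.
  rewrite JE -cz; case: eqP => [/labeling_eq ek|_]; last by rewrite mul0r.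
  by rewrite ek eqxx in kz.
have col_J x : c y = ((c x).1, (c x).2.+1) -> \sum_k M w k * shift_mx F c k y = M w x.
  move=> cy; rewrite (bigD1 x) //= JE cy eqxx mulr1 big1 ?addr0 // => k kx.
  rewrite JE cy; case: eqP => [[e1 e2]|_]; last by rewrite mulr0.
  by case/eqP: kx; apply: labeling_pair.
have [z /eqP cz|no_z] := pickP (fun z => c z == ((c w).1, (c w).2.+1)).
  rewrite (row_J z) //; case y2 : (c y).2 => [|a].
    rewrite big1 => [|k _]; first by rewrite M_bottom // cz.
    by rewrite JE [c y]surjective_pairing y2 xpair_eqE andbF mulr0.
  have [x cx] := labeling_below y2.
  have cy : c y = ((c x).1, (c x).2.+1) by rewrite cx /= -y2 -surjective_pairing.
  by rewrite (col_J x) //; apply: M_shift.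
rewrite big1 => [|k _]; last by rewrite JE no_z mul0r.
case y2 : (c y).2 => [|a].
  by rewrite big1 // => k _; rewrite JE [c y]surjective_pairing y2 xpair_eqE andbF mulr0.
have [x cx] := labeling_below y2.
have cy : c y = ((c x).1, (c x).2.+1) by rewrite cx /= -y2 -surjective_pairing.
by rewrite (col_J x) // (M_top _ y) // => z /eqP; rewrite no_z.
Qed.

Lemma labeling_lt i : ((c i).1 < R)%N /\ ((c i).2 < len (c i).1)%N.
Proof. by apply/(proj2 c_lab); exists i; rewrite -surjective_pairing. Qed.

Lemma labeling_top w : (forall w', c w' <> ((c w).1, (c w).2.+1)) -> len (c w).1 = (c w).2.+1.
Proof.
move=> w_top; have [lt_R lt_len] := labeling_lt w; apply/eqP; rewrite eqn_leq lt_len andbT.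
by rewrite leqNgt; apply/negP => lt_len';
   have [w' /w_top] := iffRL (proj2 c_lab _ _) (conj lt_R lt_len').
Qed.

(** The row of p may be mixed with rows that are at least as long, because each of
its boxes has a counterpart in the same column of such a row. *)
Lemma row_mix_mx_comm p (V : nat -> F) :
  (forall r, V r != 0 -> (len (c p).1 <= len r)%N) ->
  shift_mx F c *m row_mix_mx c p V = row_mix_mx c p V *m shift_mx F c.
Proof.
move=> V_len; apply: shift_mx_comm => [w w' y y' cw' cy|w y w0 y0|w y y' w_top cy]; rewrite !mxE.
- rewrite cy cw' /= eqSS; case: ifP => // _; congr (_%:R); congr nat_of_bool.
  apply/eqP/eqP => e.
    by have := cw'; rewrite e cy => -[e1 e2]; apply: labeling_pair.
  by apply: labeling_eq; rewrite cw' cy e.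
- case: ifP => _; first by rewrite y0 gtn_eqF.
  by case: eqP => // wy; rewrite wy y0 in w0.
- have y_lt := proj2 (labeling_lt y); rewrite cy /= in y_lt.
  case: eqP => [yp|_]; last by case: eqP => // wy; case: (w_top y); rewrite wy.
  case: eqP => // wy; apply/eqP; apply: contraT => /V_len.
  by rewrite (labeling_top w_top) -yp wy ltnNge in y_lt *; move=> le; rewrite le in y_lt.
Qed.

End ShiftMatrix.

(** * Upper bound: parametrizing the frames of a Springer fiber *)

(** A frame of a flag whose first line is spanned by the basis vector p, in terms of
a frame g of the induced flag on the quotient by that line. *)
Definition border_mx (A : pzRingType) n (p : 'I_n.+1) (rho : 'I_n -> A) (g : 'M[A]_n) :
    'M[A]_n.+1 :=
  \matrix_(i, j) if unlift ord0 j is Some j' then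
                   if unlift p i is Some i' then g i' j' else rho j'
                 else (i == p)%:R.

Lemma border_mxE (A : pzRingType) n (p : 'I_n.+1) (g : 'M[A]_n.+1) :
  (forall i, g i ord0 = (i == p)%:R) ->
  g = border_mx p (fun j => g p (lift ord0 j)) (row' p (col' ord0 g)).
Proof.
move=> g0; apply/matrixP => i j; rewrite !mxE.
case: unliftP => [j' ->|->]; last exact: g0.
by case: unliftP => [i' ->|->] //; rewrite !mxE.
Qed.

(** Removing the bottom box p and sliding its row by one step labels the remaining
vectors by the diagram with that row shortened. *)
Definition delete_bottom_labeling n (c : 'I_n.+1 -> nat * nat) (p : 'I_n.+1) (i : 'I_n) :=
  let: (r, a) := c (lift p i) in (r, if r == (c p).1 then a.-1 else a).

Section DeleteBottomBox.
Variables (F : fieldType) (R : nat) (len : nat -> nat) (n : nat) (c : 'I_n.+1 -> nat * nat).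
Hypothesis c_lab : diagram_labeling R len c.
Variable p : 'I_n.+1.
Hypothesis p_bottom : (c p).2 = 0%N.
Let c' := delete_bottom_labeling c p.
Let len' r := if r == (c p).1 then (len r).-1 else len r.

Lemma lift_positive i : (c (lift p i)).1 = (c p).1 -> (0 < (c (lift p i)).2)%N.
Proof.
move=> e1; rewrite lt0n; apply/eqP => e2.
have /eqP := labeling_pair c_lab e1 (etrans e2 (esym p_bottom)).
by rewrite eq_sym (negPf (neq_lift _ _)).
Qed.

Lemma delete_bottom_labelingP : diagram_labeling R len' c'.
Proof.
rewrite /c' /delete_bottom_labeling /len'; split=> [i j|r a].
  case ci : (c (lift p i)) => [r a]; case cj : (c (lift p j)) => [r' a'] [err].
  rewrite -err => eaa; apply: (lift_inj (h := p)); apply: (labeling_eq c_lab).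
  rewrite ci cj -err; congr pair; case: eqP eaa => // erp.
  have := lift_positive (i := i); have := lift_positive (i := j).
  by rewrite ci cj /= -err erp => /(_ erefl) ? /(_ erefl) ? /=; lia.
have [_ lab] := c_lab; split=> [[k]|[ltR lt_len]].
  case ck : (c (lift p k)) => [r' b]; case=> <- <-.
  have [ltR lt_len] : (r' < R)%N /\ (b < len r')%N by apply/lab; exists (lift p k).
  split=> //; case: eqP => // erp; have := lift_positive (i := k).
  by rewrite ck erp => /(_ erefl) /=; rewrite -erp; lia.
pose b := if r == (c p).1 then a.+1 else a.
have [z zE] : exists z, c z = (r, b).
  by apply/lab; split=> //; move: lt_len; rewrite /b; case: eqP => // _; lia.
have : z != p.
  apply/eqP => zp; move: p_bottom; rewrite -zp zE /b /= -zp zE /= eqxx //.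
case: (unliftP p z) => [i zi _|->]; last by rewrite eqxx.
exists i.
by rewrite -zi zE /b; case: eqP.
Qed.

Lemma shift_mx_delete : row' p (col' p (shift_mx F c)) = shift_mx F c'.
Proof.
apply/matrixP => i j; rewrite !mxE /c' /delete_bottom_labeling; congr (_%:R).
have := lift_positive (i := i); have := lift_positive (i := j).
case: (c (lift p i)) => [r a]; case: (c (lift p j)) => [r' a'] /=.
rewrite !xpair_eqE; case: (eqVneq r' r) => //= ->.
case: (eqVneq r (c p).1) => //= er /(_ er) ? /(_ er) ?.
by congr nat_of_bool; lia.
Qed.

Lemma shift_mx_bottom i : shift_mx F c i p = 0.
Proof. by rewrite mxE [c p]surjective_pairing p_bottom xpair_eqE andbF. Qed.

(** Column p of the shift is zero, so the equation N g = g T, with T upper triangular,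
survives the deletion of row p and of the first column of g. *)
Lemma delete_first_column g : g \in unitmx ->
  upper_triangular (invmx g *m shift_mx F c *m g) ->
  (forall i, g i ord0 = (i == p)%:R) ->
  let g' := row' p (col' ord0 g) in
  g' \in unitmx /\ upper_triangular (invmx g' *m shift_mx F c' *m g').
Proof.
move=> ug tg g0 g'.
have [T tT JT] : exists2 T, upper_triangular T & shift_mx F c *m g = g *m T.
  by exists (invmx g *m shift_mx F c *m g); rewrite // !mulmxA mulmxV // mul1mx.
have ug' : g' \in unitmx.
  move: ug; rewrite !unitmxE (expand_det_col _ ord0) (bigD1 p) //= g0 eqxx mul1r.
  rewrite big1 ?addr0 => [|i ip]; last by rewrite g0 (negPf ip) mul0r.
  by rewrite /cofactor unitrM => /andP[].
split=> //.
have JT' : shift_mx F c' *m g' = g' *m row' ord0 (col' ord0 T).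
  apply/matrixP => i j; have := congr1 (fun M : 'M_n.+1 => M (lift p i) (lift ord0 j)) JT.
  rewrite -shift_mx_delete !mxE (bigD1_ord p) //= shift_mx_bottom mul0r add0r.
  rewrite [RHS](bigD1_ord ord0) //= g0 eq_sym (negPf (neq_lift _ _)) mul0r add0r.
  move=> E; transitivity (\sum_(i0 < n) shift_mx F c (lift p i) (lift p i0) * g (lift p i0) (lift ord0 j)).
    by apply: eq_bigr => k _; rewrite !mxE.
  by rewrite E; apply: eq_bigr => k _; rewrite !mxE.
rewrite -mulmxA JT' mulKmx // => i j lt_ji; rewrite mxE mxE.
exact: (tT (lift ord0 i) (lift ord0 j)).
Qed.

End DeleteBottomBox.

Section NilpotentFrames.
Variable F : fieldType.

(** The frames of the Springer fiber over N. *)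
Definition stable_frames n (N g : 'M[F]_n) : Prop :=
  g \in unitmx /\ upper_triangular (invmx g *m N *m g).

(** In a box of largest column index on the support of v, the image of v vanishes. *)
Lemma shift_mx_eigen0 R len n (c : 'I_n -> nat * nat) (v : 'cV[F]_n) a :
  diagram_labeling R len c -> v != 0 -> shift_mx F c *m v = a *: v -> a = 0.
Proof.
move=> c_lab /cV0Pn[i0 vi0] Jv; apply/eqP; apply: contraT => a0.
pose i := [arg max_(i > i0 | v i 0 != 0) (c i).2].
have [vi i_max] : v i 0 != 0 /\ forall j, v j 0 != 0 -> ((c j).2 <= (c i).2)%N.
  by rewrite /i; case: arg_maxnP.
have : (shift_mx F c *m v) i 0 != 0 by rewrite Jv mxE mulf_neq0.
rewrite mxE; case/negP; apply/eqP; apply: big1 => j _; rewrite mxE.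
case: eqP => [cj|_]; last by rewrite mul0r.
rewrite mul1r; apply/eqP; apply: contraT => /i_max.
by rewrite cj /= ltnn.
Qed.

Lemma stable_frames_first_column R len n (c : 'I_n.+1 -> nat * nat) g :
  diagram_labeling R len c -> stable_frames (shift_mx F c) g ->
  (exists i, g i ord0 != 0) /\ forall i, g i ord0 != 0 -> (c i).2 = 0%N.
Proof.
move=> c_lab [ug tg].
have [T tT JT] : exists2 T, upper_triangular T & shift_mx F c *m g = g *m T.
  by exists (invmx g *m shift_mx F c *m g); rewrite // !mulmxA mulmxV // mul1mx.
have v0 : col ord0 g != 0.
  apply: contraTneq isT => g0; have := mulVmx ug => /(congr1 (col ord0)).
  by rewrite col_mulmx g0 mulmx0 => /colP/(_ ord0)/eqP; rewrite !mxE eqxx eq_sym oner_eq0.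
have Jv : shift_mx F c *m col ord0 g = T ord0 ord0 *: col ord0 g.
  rewrite -col_mulmx JT; apply/colP => i; rewrite !mxE big_ord_recl.
  rewrite big1 ?addr0 => [|j _]; first by rewrite mulrC.
  by rewrite (tT (lift ord0 j)) ?mulr0.
have T0 := shift_mx_eigen0 c_lab v0 Jv.
rewrite T0 scale0r in Jv.
split=> [|i gi]; first by have /cV0Pn[k gk] := v0; exists k; rewrite mxE in gk.
case i2 : (c i).2 => [//|a].
have [k ck] := labeling_below c_lab i2.
case/eqP: gi; have /colP/(_ k) := Jv; rewrite !mxE => <-.
rewrite (bigD1 i) //= !mxE ck /= -i2 -surjective_pairing eqxx mul1r big1 ?addr0 //.
move=> j ji; rewrite !mxE; case: eqP => [cj|_]; last by rewrite mul0r.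
by case/eqP: ji; apply: (labeling_eq c_lab); rewrite cj ck /= -i2 -surjective_pairing.
Qed.

(** The parameters are the entries V r for r in S, the n entries of rho, and those of
the parametrization of W. *)
Lemma covered_move_column n d K (S : seq nat) (c : 'I_n.+1 -> nat * nat) p
    (W : 'M[F]_n -> Prop) : size S = K -> injective c ->
  covered d W ->
  covered (K + n + d) (fun g : 'M[F]_n.+1 => exists V : nat -> F, exists rho, exists g',
    [/\ forall r, V r != 0 -> r \in S, W g' &
        g = row_mix_mx c p V *m border_mx p rho g']).
Proof.
move=> sizeS c_inj [l lW].
pose D := (K + n + d)%N.
pose XV r : {mpoly F[D]} := if insub (index r S) is Some k then 'X_(lshift d (lshift n (k : 'I_K))) else 0.
pose Xrho j : {mpoly F[D]} := 'X_(lshift d (rshift K (j : 'I_n))).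
pose subst (q : {mpoly F[d]}) : {mpoly F[D]} := q \mPo [tuple 'X_(rshift (K + n) i) | i < d].
exists [seq row_mix_mx c p XV *m border_mx p Xrho (map_mx subst Phi) | Phi <- l].
move=> g [V [rho [g' [VS /lW[Phi Phil [t g'E]] gE]]]].
exists (row_mix_mx c p XV *m border_mx p Xrho (map_mx subst Phi)); first exact: map_f.
(* The three groups of variables are V, rho and the old parameters, in this
   order. *)
pose t' (i : 'I_D) := match split i with
  | inl k => match split k with inl k => V (nth 0%N S k) | inr j => rho j end
  | inr i => t i end.
have tV r : meval t' (XV r) = V r.
  rewrite /XV; case: insubP => [k lt_k kE|ge_k].
    rewrite mevalXU /t' (unsplitK (inl _)) (unsplitK (inl _)) kE nth_index //.
    by rewrite -index_mem sizeS.
  rewrite meval0; apply/esym/eqP; apply: contraNT ge_k => /VS.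
  by rewrite -index_mem sizeS.
have trho j : meval t' (Xrho j) = rho j.
  by rewrite mevalXU /t' (unsplitK (inl _)) (unsplitK (inr _)).
have tsubst q : meval t' (subst q) = meval t q.
  rewrite comp_mpoly_meval; apply: meval_eq => i.
  by rewrite tnth_mktuple mevalXU /t' (unsplitK (inr _)).
exists t'; rewrite gE map_mxM; congr (_ *m _); apply/matrixP => i j.
  rewrite !mxE; case: ifP => _; last by rewrite raddfMn /= meval1.
  by case: ifP => _; rewrite /= ?tV ?meval0.
rewrite !mxE; case: unlift => [j'|]; last by rewrite raddfMn /= meval1.
case: unlift => [i'|]; last by rewrite /= trho.
by rewrite g'E !mxE /= tsubst.
Qed.

(** The pieces are indexed by a bottom box p in a shortest row among those that occur
in the first column of the frame.  On such a piece the first column is carried to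
p by a matrix in the centralizer, and deleting p leaves a smaller instance. *)
Theorem covered_stable_frames n : forall R len (c : 'I_n -> nat * nat),
  diagram_labeling R len c ->
  covered (pair_min R len + \sum_(j < n) j.+1)%N (stable_frames (shift_mx F c)).
Proof.
elim: n => [|n IH] R len c c_lab.
  exists [:: 0] => g _; exists 0; first by rewrite inE.
  by exists (fun=> 0); rewrite flatmx0 [RHS]flatmx0.
pose W p g := stable_frames (shift_mx F c) g /\ [/\ g p ord0 != 0, (c p).2 = 0%N &
  forall x, g x ord0 != 0 -> (len (c p).1 <= len (c x).1)%N].
have Wcover g : stable_frames (shift_mx F c) g -> exists p, W p g.
  move=> gs; have [[i0 gi0] gbot] := stable_frames_first_column c_lab gs.
  exists [arg min_(i < i0 | g i ord0 != 0) len (c i).1].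
  by case: arg_minnP => // p gp p_min; split=> //; split=> //; apply: gbot.
apply: covered_sub Wcover _; apply: covered_bigcup => p.
have [p_bot|p_nbot] := eqVneq (c p).2 0%N; last first.
  by exists [::] => g [_ [_ /eqP]]; rewrite (negPf p_nbot).
pose r0 := (c p).1; pose len' r := if r == r0 then (len r).-1 else len r.
pose S := [seq r <- iota 0 R | len r0 <= len r]%N.
have [lt_r0R lt_len0] : (r0 < R)%N /\ (0 < len r0)%N.
  by apply/(proj2 c_lab); exists p; rewrite -p_bot -surjective_pairing.
have -> : (pair_min R len + \sum_(j < n.+1) j.+1 =
    size S + n + (pair_min R len' + \sum_(j < n) j.+1))%N.
  have := pair_min_remove lt_r0R lt_len0; rewrite -/len' size_filter big_ord_recr /=.
  by lia.
have c_inj := proj1 c_lab.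
have lab' := delete_bottom_labelingP c_lab p_bot.
apply: covered_sub (covered_move_column p erefl c_inj (IH _ _ _ lab')).
move=> g [gs [gp _ p_min]]; have [ug tg] := gs.
have [_ gbot] := stable_frames_first_column c_lab gs.
(* V r is the coordinate of the first column at the bottom box of row r, or 0
   if there is none. *)
pose V r := \sum_(x | c x == (r, 0%N)) g x ord0.
have VE x : (c x).2 = 0%N -> V (c x).1 = g x ord0.
  move=> x2; rewrite /V (bigD1 x) /=; last by rewrite -x2 -surjective_pairing.
  rewrite big1 ?addr0 // => y /andP[/eqP cy]; case/eqP.
  by apply: (labeling_eq c_lab); rewrite cy -x2 -surjective_pairing.
have VS r : V r != 0 -> (r < R)%N && (len r0 <= len r)%N.
  move=> Vr; have [x /eqP cx|no_x] := pickP (fun x => c x == (r, 0%N)); last first.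
    by case/eqP: Vr; rewrite /V big_pred0.
  have rE : r = (c x).1 by rewrite cx.
  have [ltR _] : (r < R)%N /\ (0 < len r)%N by apply/(proj2 c_lab); exists x.
  by rewrite ltR rE p_min // -VE -?rE // cx.
have uH : row_mix_mx c p V \in unitmx by apply: row_mix_mx_unit => //; rewrite VE.
have HJ := row_mix_mx_comm c_lab (fun r Vr => proj2 (andP (VS r Vr))).
pose H := row_mix_mx c p V; pose h := invmx H *m g.
have gE : g = H *m h by rewrite mulKVmx.
have uh : h \in unitmx by rewrite unitmx_mul unitmx_inv uH.
have th : upper_triangular (invmx h *m shift_mx F c *m h).
  pose T := invmx g *m shift_mx F c *m g.
  have JT : shift_mx F c *m g = g *m T by rewrite /T !mulmxA mulmxV // mul1mx.
  have Jh : shift_mx F c *m h = h *m T.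
    apply: (can_inj (mulKmx uH)); rewrite /h -[invmx H *m g *m T]mulmxA -JT.
    by rewrite mulKVmx // mulmxA -HJ -mulmxA mulKVmx.
  by rewrite -mulmxA Jh mulKmx.
have h0 i : h i ord0 = (i == p)%:R.
  have g0 : col ord0 g = H *m delta_mx p ord0.
    rewrite -colE; apply/colP => k; rewrite !mxE eqxx p_bot.
    case: eqP => [/VE //|k2]; apply/eqP; apply: contraT => /gbot /k2 [].
  have /colP/(_ i) : col ord0 h = delta_mx p ord0.
    by rewrite col_mulmx g0 mulKmx.
  by rewrite mxE => ->; rewrite mxE eqxx andbT.
have hE := border_mxE h0.
exists V; exists (fun j => h p (lift ord0 j)); exists (row' p (col' ord0 h)); split.
- by move=> r /VS; rewrite mem_filter mem_iota add0n andbC.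
- exact: (delete_first_column c_lab p_bot uh th h0).
- by rewrite gE {1}hE.
Qed.

End NilpotentFrames.

(** * Lower bound: an affine cell in the Springer fiber *)

Section LowerBound.
Variables (F : numFieldType) (R : nat) (len : nat -> nat) (n : nat) (c : 'I_n -> nat * nat).
Hypothesis c_lab : diagram_labeling R len c.
Hypothesis len_anti : forall r r', (r' <= r)%N -> (r < R)%N -> (len r <= len r')%N.
Hypothesis c_order : forall i j : 'I_n, (i < j)%N ->
  ((c j).1 < (c i).1)%N || ((c i).1 == (c j).1) && ((c i).2 < (c j).2)%N.

(** The free coordinates of the cell.  An endomorphism commuting with the shift is
determined by its entries in the bottom row of boxes, so the coordinates are the
pairs of a bottom box z and a box x of a later row.  They are listed by decreasing
x: with this order the vanishing of the entry (z, x) can be read off the x-th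
term of the flag when the entries that follow it in the list vanish. *)
Definition cell_entries : seq ('I_n * 'I_n) :=
  sort (fun zx zx' : 'I_n * 'I_n => zx'.2 <= zx.2)%N
    (enum [pred zx | ((c zx.1).2 == 0) && ((c zx.1).1 < (c zx.2).1)]%N).

Lemma mem_cell_entries z x :
  ((z, x) \in cell_entries) = ((c z).2 == 0%N) && ((c z).1 < (c x).1)%N.
Proof. by rewrite mem_sort mem_enum. Qed.

Lemma cell_entries_uniq : uniq cell_entries.
Proof. by rewrite sort_uniq enum_uniq. Qed.

Lemma cell_entries_drop (z x q : 'I_n) k : (k < size cell_entries)%N ->
  nth (z, x) cell_entries k = (z, x) -> (q <= x)%N -> (z, q) \in cell_entries ->
  (z, q) \in drop k cell_entries.
Proof.
move=> lt_k nth_k le_qx /[dup] zq_in; rewrite -{1}(cat_take_drop k cell_entries) mem_cat.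
case/orP=> // /(nthP (z, x))[k' ]; rewrite size_takel ?(ltnW lt_k) // => lt_k' .
rewrite nth_take // => nth_k'.
have leT_tr : transitive (fun zx zx' : 'I_n * 'I_n => zx'.2 <= zx.2)%N.
  by move=> a b d /= ab bd; apply: leq_trans bd ab.
have leT_refl : reflexive (fun zx zx' : 'I_n * 'I_n => zx'.2 <= zx.2)%N by move=> a /=.
have leT_tot : total (fun zx zx' : 'I_n * 'I_n => zx'.2 <= zx.2)%N.
  by move=> a b; apply: leq_total.
have := sorted_leq_nth leT_tr leT_refl (z, x) (sort_sorted leT_tot _ : sorted _ cell_entries).
move=> /(_ k' k (ltn_trans lt_k' lt_k) lt_k (ltnW lt_k')).
rewrite nth_k nth_k' /= => le_xq.
have eq_qx : q = x by apply/val_inj/eqP; rewrite eqn_leq le_qx.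
have := nth_uniq (z, x) (ltn_trans lt_k' lt_k) lt_k cell_entries_uniq.
by rewrite nth_k nth_k' eq_qx eqxx ltn_eqF.
Qed.

Lemma labeling_sum (f : nat * nat -> nat) :
  (\sum_x f (c x) = \sum_(r < R) \sum_(a < len r) f (r : nat, a : nat))%N.
Proof.
have [c_inj lab] := c_lab.
pose boxes := [seq (r, a) | r <- iota 0 R, a <- iota 0 (len r)].
have cboxes : perm_eq [seq c x | x <- enum 'I_n] boxes.
  apply: uniq_perm => [||[r a]].
  - by rewrite map_inj_uniq ?enum_uniq.
  - by apply: allpairs_uniq_dep => [|r _|[r a] [r' a'] _ _ []]; rewrite ?iota_uniq // => -> ->.
  apply/mapP/allpairsPdep => [[x _ cx]|[r' [a' [r'R a'len []]]] -> ->].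
    have [ltR lt_len] : (r < R)%N /\ (a < len r)%N by apply/lab; exists x.
    by exists r, a; rewrite !mem_iota.
  rewrite !mem_iota /= !add0n in r'R a'len.
  by have [x cx] := iffRL (lab r' a') (conj r'R a'len); exists x; rewrite ?mem_enum.
rewrite -[LHS](big_enum _ _ 'I_n) -(big_map c xpredT f) (perm_big _ cboxes).
have iotaE m : iota 0 m = index_iota 0 m by rewrite /index_iota subn0.
rewrite big_allpairs_dep iotaE big_mkord.
by apply: eq_bigr => r _; rewrite iotaE big_mkord.
Qed.

(** A box of row r forms a free coordinate with each of the r bottom boxes above
its row, and for decreasing lengths the sum of r * len r is pair_min. *)
Lemma size_cell_entries : size cell_entries = pair_min R len.
Proof.
rewrite size_sort -cardE -sum1_card.
rewrite -(pair_big_dep xpredT (fun z x => ((c z).2 == 0%N) && ((c z).1 < (c x).1)%N)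
  (fun _ _ => 1%N)) (exchange_big_dep xpredT) //=.
rewrite (eq_bigr (fun x => (c x).1)) => [|x _].
  rewrite (labeling_sum (fun ra => ra.1)); apply: eq_bigr => r _ /=.
  transitivity (\sum_(r' < r) len r)%N; first by rewrite !sum_nat_const !card_ord mulnC.
  by apply: eq_bigr => r' _; apply/esym/minn_idPr/len_anti => //; apply: ltnW.
have ltR := proj1 (labeling_lt c_lab x).
pose f ra := ((ra.2 == 0%N) && (ra.1 < (c x).1)%N : nat).
rewrite big_mkcond (eq_bigr (fun z => f (c z))) => [|z _]; last by rewrite /f; case: ifP.
rewrite labeling_sum /f /= (eq_bigr (fun r : 'I_R => nat_of_bool (r < (c x).1)%N)) => [|r _].
  elim: R (c x).1 {f} ltR => // m IH k; rewrite ltnS leq_eqVlt big_ord_recr /=.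
  case/orP => [/eqP ->|lt_km]; last by rewrite IH //; lia.
  rewrite ltnn /= addn0 (eq_bigr (fun=> 1%N)) => [|i _]; last by rewrite ltn_ord.
  by rewrite sum_nat_const card_ord muln1.
rewrite sum_ord_eq; case: (ltnP r (c x).1) => [lt_rx|_]; last by rewrite andbF.
have := proj2 (labeling_lt c_lab x); have := len_anti (ltnW lt_rx) ltR.
by rewrite andbT; lia.
Qed.

(** When k is the number of free coordinates, a unipotent subgroup of the
centralizer; for smaller k, one of its coordinate subspaces. *)
Definition cell (k : nat) (g : 'M[F]_n) : Prop :=
  [/\ shift_mx F c *m g = g *m shift_mx F c,
      forall z, g z z = 1,
      forall z x, z != x -> ~~ ((c z).1 < (c x).1)%N -> g z x = 0
    & forall zx, zx \in drop k cell_entries -> g zx.1 zx.2 = 0].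

Lemma cell_line_closed k : line_closed (cell k).
Proof.
move=> s g h [gJ g1 g0 gk] [hJ h1 h0 hk]; split.
- by rewrite mulmxDr mulmxDl -scalemxAr -scalemxAl mulmxBr mulmxBl gJ hJ.
- by move=> z; rewrite !mxE g1 h1 subrr mulr0 addr0.
- by move=> z x zx lt_zx; rewrite !mxE g0 // h0 // subrr mulr0 addr0.
- by move=> zx zx_in; rewrite !mxE gk // hk // subrr mulr0 addr0.
Qed.

Lemma cell_sub k g : cell k g -> cell k.+1 g.
Proof.
move=> [gJ g1 g0 gk]; split=> // zx zx_in; apply: gk.
by rewrite -[k.+1]add1n -drop_drop in zx_in; apply: mem_drop zx_in.
Qed.

Lemma cell1 k : cell k 1%:M.
Proof.
split=> [|z|z x /negPf zx _|[z x] /mem_drop]; rewrite ?mul1mx ?mulmx1 // ?mxE ?eqxx ?zx //.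
by rewrite mem_cell_entries /= => /andP[_]; case: (eqVneq z x) => // ->; rewrite ltnn.
Qed.

Lemma row_gt_order z x : ((c z).1 < (c x).1)%N -> (x < z)%N.
Proof.
move=> lt_zx; rewrite ltnNge leq_eqVlt negb_or; apply/andP; split.
  by apply: contraL lt_zx => /eqP/val_inj ->; rewrite ltnn.
by apply: contraL lt_zx => /c_order /orP[/ltnW|/andP[/eqP -> _]]; rewrite -leqNgt.
Qed.

Lemma cell_unitmx k g : cell k g -> g \in unitmx.
Proof.
move=> [_ g1 g0 _]; rewrite unitmxE det_trig.
  by rewrite big1 ?unitr1 // => z _; rewrite g1.
apply/is_trig_mxP => z x lt_zx; apply: g0; first by rewrite -(inj_eq val_inj) ltn_eqF.
by apply/negP => /row_gt_order; rewrite ltnNge (ltnW lt_zx).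
Qed.

Lemma upper_triangular_shift : upper_triangular (shift_mx F c).
Proof.
move=> i j lt_ji; rewrite mxE; case: eqP => // cj.
by have := c_order lt_ji; rewrite cj /= ltnn eqxx ltnNge leqnSn.
Qed.

(** The k-th coordinate can be switched on alone: adding to row (c x).1 a shifted
copy of row (c z).1 commutes with the shift, because row (c z).1 is at
least as long. *)
Lemma cell_next z x k : (k < size cell_entries)%N -> nth (z, x) cell_entries k = (z, x) ->
  exists2 g, cell k.+1 g & g z x = 1.
Proof.
move=> lt_k nth_k.
have := mem_nth (z, x) lt_k; rewrite nth_k mem_cell_entries => /andP[/eqP z2 lt_zx].
pose E : 'M[F]_n := \matrix_(w, y)
  [&& (c w).1 == (c z).1, (c y).1 == (c x).1 & (c y).2 == (c w).2 + (c x).2]%N%:R.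
have EJ : shift_mx F c *m E = E *m shift_mx F c.
  apply: (shift_mx_comm c_lab) => [w w' y y' cw' cy|w y w0 y0|w y y' w_top cy]; rewrite !mxE.
  - by rewrite cy cw' /= addSn eqSS.
  - by rewrite y0 -[0%N == _]/(_) ; case: eqP => //= _; case: eqP => //= _; case: eqP => // e; lia.
  - case: eqP => //= ewz; case: eqP => //= eyx; case: eqP => //= e.
    have [_] := labeling_lt c_lab y; rewrite cy /= eyx.
    have ltR := proj1 (labeling_lt c_lab x).
    have := len_anti (ltnW lt_zx) ltR; have := labeling_top c_lab w_top; rewrite ewz.
    by lia.
have zx : z != x by apply: contraTneq lt_zx => ->; rewrite ltnn.
exists (1%:M + E); last by rewrite !mxE (negPf zx) !eqxx z2 add0n eqxx add0r.
split.
- by rewrite mulmxDr mulmxDl mul1mx mulmx1 EJ.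
- move=> w; rewrite !mxE eqxx; case: eqP => //= [->|_]; last by rewrite addr0.
  by rewrite (ltn_eqF lt_zx) addr0.
- move=> w y /negPf wy le_yw; rewrite !mxE wy add0r.
  by case: eqP => //= ew; case: eqP => //= ey; rewrite ew ey lt_zx in le_yw.
- move=> [w y] /= wy_in; have := mem_drop wy_in; rewrite mem_cell_entries => /andP[/eqP w2 lt_wy].
  rewrite !mxE w2 add0n; have -> : (w == y) = false by case: eqP lt_wy => // ->; rewrite ltnn.
  rewrite add0r; case: eqP => //= ew; case: eqP => //= ey; case: eqP => //= ey2.
  have Ew : w = z by apply: (labeling_pair c_lab); rewrite // w2 z2.
  have Ey : y = x by apply: (labeling_pair c_lab).
  move: wy_in; rewrite Ew Ey => zx_in.
  have := drop_uniq k cell_entries_uniq; rewrite (drop_nth (z, x)) // nth_k /=.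
  by rewrite zx_in.
Qed.

Local Open Scope classical_set_scope.

Variable (a N : 'M[F]_n).
Hypothesis ua : a \in unitmx.
Hypothesis NaJ : N *m a = a *m shift_mx F c.

Definition cell_flags k : set (flag F n) :=
  [set V | exists2 g, cell k g & adapted (a *m g) V].

Lemma cell_flag_exists k g : cell k g -> exists2 V, cell_flags k V & adapted (a *m g) V.
Proof.
move=> gk; have [|V gV] := @exists_flag F n (a *m g).
  by rewrite unitmx_mul ua (cell_unitmx gk).
by exists V => //; exists g.
Qed.

Lemma cell_flags_springer k : cell_flags k `<=` springer_fiber N.
Proof.
move=> V [g gk agV]; have [gJ _ _ _] := gk; have ug := cell_unitmx gk.
apply/(springer_adapted _ agV).
have NagJ : N *m (a *m g) = a *m g *m shift_mx F c.
  by rewrite mulmxA NaJ -mulmxA gJ mulmxA.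
have uag : a *m g \in unitmx by rewrite unitmx_mul ua.
by rewrite -mulmxA NagJ mulKmx //; apply: upper_triangular_shift.
Qed.

(** The cell is an affine-linear family of invertible matrices, so the polynomials
defining A and B can be tested on it. *)
Lemma cell_flags_irreducible k (A B : set (flag F n)) : closed A -> closed B ->
  cell_flags k `<=` A `|` B -> cell_flags k `<=` A \/ cell_flags k `<=` B.
Proof.
move=> /flag_closedP[S SA] /flag_closedP[S' SB] kAB.
rewrite -implyNp => /existsNP[V /not_implyP[[g gk gV] nAV]] V' [g' g'k g'V'].
apply: contrapT => nBV'.
have /existsNP[p /not_implyP[Sp pg]] : ~ (forall p, S p -> mx_eval p (a *m g) = 0).
  by move/(SA _ _ gV).
have /existsNP[q /not_implyP[Sq qg']] : ~ (forall p, S' p -> mx_eval p (a *m g') = 0).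
  by move/(SB _ _ g'V').
have [p' p'E] := mx_eval_mulmx p a 1%:M; have [q' q'E] := mx_eval_mulmx q a 1%:M.
have [] := prime_set_line_closed (@cell_line_closed k) (p := p') (q := q').
- move=> h [hk uh]; rewrite p'E q'E !mulmx1; have [U Uk hU] := cell_flag_exists hk.
  case: (kAB U Uk) => [AU|BU].
    by rewrite (iffLR (SA _ _ hU) AU p Sp) mul0r.
  by rewrite (iffLR (SB _ _ hU) BU q Sq) mulr0.
- by move=> /(_ g (conj gk (cell_unitmx gk))); rewrite p'E mulmx1.
- by move=> /(_ g' (conj g'k (cell_unitmx g'k))); rewrite q'E mulmx1.
Qed.

(** The chain consists of the closures of the images of the cells.  The k-th closure
is contained in the locus where the entry (z, x) of the frame vanishes, in the
coordinates given by a, while the next cell leaves this locus. *)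
Theorem springer_fiber_chain : irreducible_chain (springer_fiber N) (pair_min R len).
Proof.
exists (fun k => springer_fiber N `&` closure (cell_flags k)).
have sub k : cell_flags k `<=` springer_fiber N `&` closure (cell_flags k).
  by move=> V Vk; split; [apply: cell_flags_springer Vk | apply: subset_closure].
split=> k le_k.
  split; first by exists (closure (cell_flags k)) => //; apply: closed_closure.
  split; first by have [V Vk _] := cell_flag_exists (cell1 k); exists V; apply: sub.
  move=> A B Acl Bcl kAB.
  have closure_sub (C : set (flag F n)) : closed C -> cell_flags k `<=` C ->
      springer_fiber N `&` closure (cell_flags k) `<=` C.
    by move=> Ccl kC V [_ kV]; apply: Ccl; apply: closureS kC _ kV.
  have [kA|kB] := cell_flags_irreducible Acl Bcl (subset_trans (sub k) kAB).
    by left; apply: closure_sub.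
  by right; apply: closure_sub.
rewrite -size_cell_entries in le_k.
split.
  apply: setIS; apply: closureS => V [g gk gV]; exists g => //; exact: cell_sub.
case nthE : (tnth (in_tuple cell_entries) (Ordinal le_k)) => [z x].
have nth_k : nth (z, x) cell_entries k = (z, x) by rewrite -{2}nthE (tnth_nth (z, x)).
have [p pE] := mx_eval_mulmx 'X_(mxvec_index z x) (invmx a) 1%:M.
have pE' h : mx_eval p h = (invmx a *m h) z x by rewrite pE mulmx1 mx_eval_coord.
have /andP[_ lt_zx] : ((c z).2 == 0%N) && ((c z).1 < (c x).1)%N.
  by rewrite -mem_cell_entries -nth_k mem_nth.
have k_van : cell_flags k `<=` vanishing_locus p.
  move=> V [g [_ _ g0 gk] gV] h hV; rewrite pE'.
  have ug := adapted_unitmx gV.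
  (* Any other frame of the flag of a * g differs from it by an upper triangular
     factor, so only the entries (z, q) of g with q at most x are involved. *)
  have -> : invmx a *m h = g *m (invmx (a *m g) *m h).
    by rewrite -[in LHS](mulKVmx ug h) -[a *m g *m _]mulmxA mulKmx.
  rewrite mxE big1 // => q _; have [le_qx|lt_xq] := leqP q x; last first.
    by rewrite (adapted_upper gV hV) ?mulr0.
  have [lt_zq|le_qz] := boolP ((c z).1 < (c q).1)%N.
    rewrite (gk (z, q)) ?mul0r //; apply: (cell_entries_drop le_k nth_k le_qx).
    rewrite mem_cell_entries lt_zq andbT.
    by have := mem_nth (z, x) le_k; rewrite nth_k mem_cell_entries => /andP[].
  rewrite g0 ?mul0r //; apply: contraTneq lt_zx => zq.
  by apply/negP => /row_gt_order; rewrite zq ltnNge le_qx.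
move=> kk; have [g gk gzx] := cell_next le_k nth_k.
have [V Vk gV] := cell_flag_exists gk.
have [_] : (springer_fiber N `&` closure (cell_flags k)) V by apply: kk; apply: sub.
move=> /(closureS k_van)/(@closed_vanishing_locus _ _ p)/(_ _ gV)/eqP.
by rewrite pE' mulKmx // gzx oner_eq0.
Qed.

End LowerBound.

(** * The dimension of a Springer fiber *)

Section JordanLabeling.
Variables (F : fieldType) (n : nat) (la : seq nat).
Hypothesis sum_la : sumn la = n.

Definition jordan_label (i : 'I_n) := (reshape_index la i, reshape_offset la i).

Lemma jordan_label_inj : injective jordan_label.
Proof.
move=> i j [ei ej]; apply/val_inj => /=.
by rewrite -(reshape_indexK la i) ei ej reshape_indexK.
Qed.

Lemma jordan_labelP : diagram_labeling (size la) (nth 0%N la) jordan_label.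
Proof.
split; first exact: jordan_label_inj.
move=> r a; split=> [[z [<- <-]]|[_ lt_a]].
  by rewrite reshape_indexP ?reshape_offsetP ?sum_la.
have lt_n : (flatten_index la r a < n)%N by rewrite -sum_la flatten_indexP.
by exists (Ordinal lt_n); rewrite /jordan_label /= flatten_indexKl ?flatten_indexKr.
Qed.

Lemma jordan_mx_shift : jordan_mx F n la = shift_mx F jordan_label.
Proof.
apply/matrixP => i j; rewrite !mxE /jordan_label xpair_eqE andbC eq_sym.
congr (_%:R); congr nat_of_bool; case: eqP => //= er; rewrite ?andbF //.
have := reshape_indexK la i; have := reshape_indexK la j.
by rewrite /flatten_index -er; lia.
Qed.

Definition box_order (i j : 'I_n) : bool :=
  ((jordan_label j).1 < (jordan_label i).1)%N ||
  ((jordan_label i).1 == (jordan_label j).1) && ((jordan_label i).2 <= (jordan_label j).2)%N.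

(** The flag that is moved by the cell passes through the rows from the shortest to
the longest, so the boxes are renumbered accordingly. *)
Lemma ordered_relabeling : exists s : 'S_n, forall i j : 'I_n, (i < j)%N ->
  let c k := jordan_label (s k) in
  ((c j).1 < (c i).1)%N || ((c i).1 == (c j).1) && ((c i).2 < (c j).2)%N.
Proof.
pose l := sort box_order (enum 'I_n).
have size_l : size l = n by rewrite size_sort size_enum_ord.
have l_uniq : uniq l by rewrite sort_uniq enum_uniq.
have order_tr : transitive box_order by rewrite /box_order => j i k; lia.
have order_refl : reflexive box_order by rewrite /box_order => i; lia.
have order_tot : total box_order by rewrite /box_order => i j; lia.
have f_inj : injective (fun i : 'I_n => nth i l i).
  move=> i j /eqP; rewrite (set_nth_default i) ?size_l // nth_uniq ?size_l //.
  by move=> /eqP/val_inj.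
exists (perm f_inj) => i j lt_ij /=; rewrite !permE /=.
rewrite [nth j l j](set_nth_default i) ?size_l //.
have := sorted_leq_nth order_tr order_refl i (sort_sorted order_tot (enum 'I_n)).
move=> /(_ i j); rewrite !inE -/l size_l !ltn_ord => /(_ isT isT (ltnW lt_ij)).
rewrite /box_order => /orP[->//|/andP[e1 le2]].
apply/orP; right; rewrite e1 ltn_neqAle le2 andbT.
apply/negP => /eqP e2; have : nth i l i = nth i l j.
  by apply: jordan_label_inj; congr pair; [apply/eqP: e1 | apply: e2].
by move=> /eqP; rewrite nth_uniq ?size_l // => /eqP eij; rewrite eij ltnn in lt_ij.
Qed.

End JordanLabeling.

Lemma diagram_labeling_perm R len n (c : 'I_n -> nat * nat) (s : 'S_n) :
  diagram_labeling R len c -> diagram_labeling R len (fun k => c (s k)).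
Proof.
move=> [c_inj lab]; split=> [i j /c_inj/perm_inj //|r a]; rewrite -lab.
by split=> [[z <-]|[z <-]]; [exists (s z) | exists (s^-1%g z); rewrite permKV].
Qed.

Lemma shift_mx_perm (F : fieldType) n (c : 'I_n -> nat * nat) (s : 'S_n) :
  shift_mx F c *m perm_mx s^-1 = perm_mx s^-1 *m shift_mx F (fun k => c (s k)).
Proof.
have -> : shift_mx F (fun k => c (s k)) = perm_mx s *m shift_mx F c *m perm_mx s^-1.
  by rewrite -row_permE -col_permE; apply/matrixP => i j; rewrite !mxE.
by rewrite !mulmxA -perm_mxM mulVg perm_mx1 mul1mx.
Qed.

Section Dimension.
Variables (F : numFieldType) (n : nat) (la : seq nat).

Theorem springer_fiber_dim (N : 'M[F]_n) : nilpotent_of_type la N ->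
  has_dim (springer_fiber N) (pair_min (size la) (nth 0%N la)).
Proof.
move=> [/and3P[la_sorted _ /eqP sum_la] [P uP PN]].
have [s c_order] := ordered_relabeling sum_la.
set c := fun k => jordan_label la (s k) in c_order.
have c_lab : diagram_labeling (size la) (nth 0%N la) c.
  exact/diagram_labeling_perm/jordan_labelP.
have len_anti r r' : (r' <= r)%N -> (r < size la)%N -> (nth 0 la r <= nth 0 la r')%N.
  move=> le_r lt_r; have geq_tr : transitive geq by move=> x y z xy yz; apply: leq_trans yz xy.
  have := sorted_leq_nth geq_tr leqnn 0%N la_sorted; apply=> //; rewrite inE //.
  exact: leq_ltn_trans lt_r.
pose a := invmx P *m perm_mx s^-1 : 'M[F]_n.
have ua : a \in unitmx by rewrite unitmx_mul unitmx_inv uP unitmx_perm.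
have NaJ : N *m a = a *m shift_mx F c.
  rewrite /a -[in RHS]mulmxA -shift_mx_perm -jordan_mx_shift // !mulmxA.
  congr (_ *m _); apply: (can_inj (mulKmx uP)).
  by rewrite mulKVmx // mulmxA (simmxP uP PN) mulmxK.
split; first exact: (springer_fiber_chain c_lab len_anti c_order ua NaJ).
move=> m /trdeg_ge_chain X_trdeg.
have := covered_mull (a := invmx a) _ (covered_stable_frames F c_lab).
rewrite unitmx_inv => /(_ ua) cov.
rewrite -(leq_add2l (\sum_(j < n) j.+1)) [leqRHS]addnC.
apply: trdeg_ge_covered X_trdeg (covered_sub _ cov) => g [V NV gV].
have ug := adapted_unitmx gV; split; first by rewrite unitmx_mul unitmx_inv ua.
have := iffLR (springer_adapted N gV) NV.
suff -> : invmx (invmx a *m g) *m shift_mx F c *m (invmx a *m g) = invmx g *m N *m g by [].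
have uag : invmx a *m g \in unitmx by rewrite unitmx_mul unitmx_inv ua.
rewrite -mulmxA; apply: (canLR (mulKmx uag)); apply: (can_inj (mulKmx ua)).
by rewrite !mulmxA -NaJ !(mulmxK, mulmxV) // mul1mx.
Qed.

End Dimension.

(** * Springer inversions, counted row by row *)

Section Tableaux.
Local Open Scope nat_scope.

Definition below (S : seq nat) (i : nat) : nat := count (fun y => y < i) S.

(** The entries of an increasing row that are less than i form an initial segment. *)
Lemma nth_lt_below S i k : sorted ltn S -> k < size S -> (nth 0 S k < i) = (k < below S i).
Proof.
rewrite /below; elim: S k => // x S IH k /= S_sorted lt_k.
have x_min : all (ltn x) S by apply: order_path_min S_sorted => //; apply: ltn_trans.
have [lt_xi|le_ix] := ltnP x i.
  by case: k lt_k => //= k lt_k; rewrite IH ?(path_sorted S_sorted) // add1n.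
have -> : count (fun y => y < i) S = 0.
  apply/eqP; rewrite -leqn0 leqNgt -has_count; apply/hasPn => y /(allP x_min) /= lt_xy.
  by rewrite -leqNgt (leq_trans le_ix) // ltnW.
rewrite addn0 ltn0; apply/negbTE; rewrite -leqNgt.
case: k lt_k => //= k lt_k; apply: leq_trans le_ix _; apply/ltnW.
exact: (allP x_min) (mem_nth 0 lt_k).
Qed.

Lemma below_leq_size S i : below S i <= size S.
Proof. exact: count_size. Qed.

Lemma below_nth S k : sorted ltn S -> k < size S -> below S (nth 0 S k) = k.
Proof.
move=> S_sorted lt_k; apply/eqP; rewrite eqn_leq.
rewrite leqNgt -nth_lt_below // ltnn /=.
case: k lt_k => // k lt_k; rewrite -nth_lt_below ?(ltnW lt_k) //.
by apply: (sorted_ltn_nth ltn_trans) => //; rewrite inE ltnW.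
Qed.

Lemma uniq_flatten_nth (T : eqType) (s : seq (seq T)) r r' x : uniq (flatten s) ->
  x \in nth [::] s r -> x \in nth [::] s r' -> r = r'.
Proof.
elim: s r r' => [|t s IH] [|r] [|r'] //=; rewrite cat_uniq => /and3P[_ /hasPn dis s_uniq].
- move=> xt xr'; have : x \in flatten s.
    apply/flattenP; exists (nth [::] s r') => //; apply: mem_nth.
    by rewrite ltnNge; apply: contraL xr' => /(nth_default _) ->.
  by move/dis; rewrite /= xt.
- move=> xr xt; have : x \in flatten s.
    apply/flattenP; exists (nth [::] s r) => //; apply: mem_nth.
    by rewrite ltnNge; apply: contraL xr => /(nth_default _) ->.
  by move/dis; rewrite /= xt.
- by move=> xr xr'; congr _.+1; apply: IH.
Qed.

Section CountingInversions.
Variable s : seq (seq nat).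
Hypothesis s_uniq : uniq (flatten s).
Hypothesis s_sorted : all (sorted ltn) s.
Let row r := nth [::] s r.

Lemma row_sorted r : sorted ltn (row r).
Proof. by have [lt_r|le_r] := ltnP r (size s); [apply: (all_nthP [::] s_sorted)|rewrite /row nth_default]. Qed.

Lemma row_of_mem r x : x \in row r -> row_of s x = r.
Proof.
move=> xr; apply: (uniq_flatten_nth s_uniq _ xr).
apply: (@nth_find _ [::] (fun t => x \in t)); apply/hasP; exists (row r) => //.
by apply: mem_nth; rewrite ltnNge; apply: contraL xr => /(nth_default [::]); rewrite /row => ->.
Qed.

Lemma col_of_nth r k : k < size (row r) -> col_of s (nth 0 (row r) k) = k.
Proof.
move=> lt_k; rewrite /col_of (row_of_mem (r := r)) ?mem_nth // index_uniq //.
exact: (sorted_uniq ltn_trans ltnn (row_sorted r)).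
Qed.

Lemma col_of_mem r x : x \in row r -> col_of s x = below (row r) x.
Proof.
move=> xr; rewrite -{1}(nth_index 0 xr) col_of_nth ?index_mem //.
by rewrite -[in RHS](nth_index 0 xr) below_nth ?index_mem ?row_sorted.
Qed.

(** Row r is still ahead of row r' once i has been added at the end of row r', where
only the entries less than i are present and a tie is won by the higher row. *)
Definition ahead_after (r' r i : nat) : bool :=
  ((below (row r') i).+1 < below (row r) i) ||
  ((below (row r') i).+1 == below (row r) i) && (r < r').

(** Condition (2) on the right neighbour of j says that j is the last entry of its
row among those less than i, which leaves one candidate in each row. *)
Lemma springer_inversion_nth r' r i k : i \in row r' -> k < size (row r) ->
  springer_inversion s i (nth 0 (row r) k) =
  (k == (below (row r) i).-1) && ahead_after r' r i.
Proof.
move=> ir' lt_k; have jr : nth 0 (row r) k \in row r by apply: mem_nth.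
rewrite /springer_inversion /right_of (row_of_mem ir') (row_of_mem jr).
rewrite col_of_nth // (col_of_mem ir') -/(row r) nth_lt_below ?row_sorted // /ahead_after.
have below_le := below_leq_size (row r) i.
have [err'|ner] := eqVneq r r'; first by rewrite err' in below_le *; lia.
have -> : (if onth (row r) k.+1 is Some x then i < x else true) = ~~ (k.+1 < below (row r) i).
  have [lt_k'|le_k'] := ltnP k.+1 (size (row r)); last first.
    have -> : onth (row r) k.+1 = None by apply: onth_default.
    by apply/esym; rewrite -leqNgt (leq_trans below_le).
  have -> : onth (row r) k.+1 = Some (nth 0 (row r) k.+1) by rewrite onthE (nth_map 0).
  rewrite -nth_lt_below ?row_sorted // -leqNgt [RHS]leq_eqVlt.
  case: eqP => // e; case/eqP: ner; apply: (uniq_flatten_nth s_uniq) ir'.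
  by rewrite e mem_nth.
lia.
Qed.

Lemma num_springer_inversionsE : num_springer_inversions s =
  \sum_(r' < size s) \sum_(i <- row r') \sum_(r < size s) ahead_after r' r i.
Proof.
rewrite /num_springer_inversions -sum1_count big_mkcond big_allpairs big_flatten.
rewrite (big_nth [::]) big_mkord; apply: eq_bigr => r' _.
rewrite big_seq [RHS]big_seq; apply: eq_bigr => i ir'.
rewrite big_flatten (big_nth [::]) big_mkord; apply: eq_bigr => r _.
rewrite (big_nth 0) big_mkord.
transitivity (\sum_(k < size (row r)) ((k == (below (row r) i).-1 :> nat) && ahead_after r' r i)).
  by apply: eq_bigr => k _; rewrite -springer_inversion_nth //; case: ifP.
rewrite sum_ord_eq; case O : (ahead_after r' r i); last by rewrite andbF.
move: O; have := below_leq_size (row r) i; rewrite /ahead_after; lia.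
Qed.

End CountingInversions.

(** * Tableaux that break up into blocks *)

Definition block (d m : nat) : seq nat := iota (d * m.-1).+1 d.

Definition inflate (d : nat) (r : seq nat) : seq nat := flatten [seq block d m | m <- r].

Lemma inflate_cons d m r : inflate d (m :: r) = block d m ++ inflate d r.
Proof. by []. Qed.

Lemma inflate_flatten d q : flatten [seq inflate d r | r <- q] = inflate d (flatten q).
Proof.
rewrite /inflate; elim: q => //= r q ->; by rewrite map_cat flatten_cat.
Qed.

Lemma mem_block_last d m : 0 < d -> 0 < m -> d * m \in block d m.
Proof. by move=> d0 m0; rewrite mem_iota; case: m m0 => //= m _; nia. Qed.

Lemma mem_inflate_last d m r : 0 < d -> 0 < m -> m \in r -> d * m \in inflate d r.
Proof.
by move=> d0 m0 mr; apply/flatten_mapP; exists m => //; apply: mem_block_last.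
Qed.

(** By induction on a: the number that precedes the first entry a of a block belongs to
a block that is aligned, and must be its last entry, since two blocks that share
an element are equal. *)
Lemma block_aligned d (bs : seq (seq nat)) N : 0 < d ->
  perm_eq (flatten bs) (iota 1 N) -> (forall b, b \in bs -> is_block d b) ->
  forall b, b \in bs -> exists2 m, 0 < m & b = block d m.
Proof.
move=> d0 bs_perm bs_block.
have bs_uniq : uniq (flatten bs) by rewrite (perm_uniq bs_perm) iota_uniq.
have mem_bs x : (x \in flatten bs) = (0 < x <= N) by rewrite (perm_mem bs_perm) mem_iota; lia.
suff aligned a : iota a d \in bs -> (0 < a) && (d %| a.-1).
  move=> b b_in; have [a bE] := bs_block b b_in; move: b_in; rewrite bE => /aligned.
  case/andP=> a0 /dvdnP[k ak]; exists k.+1 => //.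
  by rewrite /block /= mulnC -ak prednK.
elim/ltn_ind: a => a IH a_in.
have a_iota : a \in iota a d by rewrite mem_iota leqnn /= -{1}[a]addn0 ltn_add2l.
have : a \in flatten bs by apply/flattenP; exists (iota a d).
rewrite mem_bs => /andP[a0 a_le]; rewrite a0 /=.
have [->|a_neq1] := eqVneq a 1; first by rewrite dvdn0.
have : a.-1 \in flatten bs by rewrite mem_bs; lia.
(* The block of a.-1 starts at some a' < a, aligned by induction; it cannot
   reach a. *)
move=> /flattenP[b b_in]; have [a' bE] := bs_block b b_in; rewrite bE in b_in *.
rewrite mem_iota => /andP[le_a' lt_a'].
have lt_a'a : a' < a by lia.
have /andP[a'0 d_a'] := IH a' lt_a'a b_in.
have -> : a.-1 = a'.-1 + d; last by rewrite dvdn_addl.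
suff : ~~ (a < a' + d) by lia.
apply/negP => lt_a.
have a_iota' : a \in iota a' d by rewrite mem_iota lt_a (ltnW lt_a'a).
have := uniq_flatten_nth (r := index (iota a d) bs) (r' := index (iota a' d) bs) bs_uniq.
move=> /(_ a); rewrite !nth_index // => /(_ a_iota a_iota') e.
have : iota a d = iota a' d by rewrite -[LHS](nth_index [::] a_in) e nth_index.
by case: (d) d0 => //= d' _ [ea _]; rewrite ea ltnn in lt_a'a.
Qed.

Lemma divisor_inflate d s N : divisor d s -> perm_eq (flatten s) (iota 1 N) ->
  exists2 q, s = [seq inflate d r | r <- q] & all (fun m => 0 < m) (flatten q).
Proof.
move=> [d0 s_div] s_perm.
have [bss sE bss_block] : exists2 bss, s = [seq flatten bs | bs <- bss] &
    forall b, b \in flatten bss -> is_block d b.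
  elim: s s_div {s_perm} => [|r s IH] s_div; first by exists [::].
  have [bs [rE bs_block]] := s_div r (mem_head _ _).
  have [|bss sE bss_block] := IH; first by move=> r' r's; apply: s_div; rewrite inE r's orbT.
  exists (bs :: bss); first by rewrite /= -rE -sE.
  by move=> b /=; rewrite mem_cat => /orP[/bs_block|/bss_block].
have flE : flatten s = flatten (flatten bss).
  by rewrite sE; elim: (bss) => //= bs bss' ->; rewrite flatten_cat.
rewrite flE in s_perm.
have {bss_block} bss_block := block_aligned d0 s_perm bss_block.
rewrite sE; elim: (bss) bss_block {sE s_perm flE} => [|bs bss' IH] bss_block; first by exists [::].
have [|q qE q_pos] := IH; first by move=> b b_in; apply: bss_block; rewrite /= mem_cat b_in orbT.
have [r [rE r_pos]] : exists r, flatten bs = inflate d r /\ all (fun m => 0 < m) r.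
  have : forall b, b \in bs -> exists2 m, 0 < m & b = block d m.
    by move=> b b_in; apply: bss_block; rewrite /= mem_cat b_in.
  elim: (bs) => [|b bs' IH'] bs_block; first by exists [::].
  have [|r [rE r_pos]] := IH'; first by move=> b' b'_in; apply: bs_block; rewrite inE b'_in orbT.
  have [m m0 bE] := bs_block b (mem_head _ _).
  by exists (m :: r); rewrite /= m0 r_pos rE bE inflate_cons.
by exists (r :: q); rewrite /= ?rE ?qE // all_cat r_pos.
Qed.

Lemma size_inflate d r : size (inflate d r) = d * size r.
Proof.
by elim: r => [|m r IH]; rewrite ?muln0 // inflate_cons size_cat size_iota IH mulnS.
Qed.

Lemma block_label_block d m : 0 < d -> 0 < m -> block_label d (block d m) = m.
Proof.
move=> d0 m0; rewrite /block_label /block.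
have -> : [seq x <- iota (d * m.-1).+1 d | d %| x] = [:: d * m].
  case: d d0 => // d' _; rewrite -[X in iota _ X]addn1 iotaD filter_cat /=.
  rewrite (_ : _ + d' = d'.+1 * m); last by case: m m0 => //= m _; rewrite mulnS; lia.
  rewrite dvdn_mulr // (@eq_in_filter _ _ pred0) ?filter_pred0 // => x.
  rewrite mem_iota => x_in; apply/negbTE/negP => /dvdnP[k xk].
  case: m m0 x_in => //= m _ x_in; rewrite xk in x_in.
  by have [le_km|lt_mk] := leqP k m; nia.
by rewrite /= mulKn.
Qed.

Lemma blocks_inflate d r : 0 < d -> blocks d (inflate d r) = [seq block d m | m <- r].
Proof.
move=> d0; rewrite /blocks size_inflate mulKn //.
rewrite -[RHS]flattenK; congr (reshape _ _).
by elim: r => //= m r <-; rewrite size_iota.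
Qed.

Lemma quotient_inflate d q : 0 < d -> all (fun m => 0 < m) (flatten q) ->
  quotient_tableau d [seq inflate d r | r <- q] = q.
Proof.
move=> d0; rewrite /quotient_tableau -map_comp.
elim: q => //= r q IH; rewrite all_cat => /andP[r_pos /IH ->]; congr (_ :: _).
rewrite blocks_inflate // -map_comp -[RHS]map_id; apply/eq_in_map => m /(allP r_pos) m0 /=.
exact: block_label_block.
Qed.

Lemma inflate_uniq d r : 0 < d -> all (fun m => 0 < m) r -> uniq (inflate d r) -> uniq r.
Proof.
move=> d0; elim: r => //= m r IH /andP[m0 r_pos].
rewrite inflate_cons cat_uniq => /and3P[_ /hasPn dis /(IH r_pos) ->]; rewrite andbT.
apply/negP => mr; have /dis := mem_inflate_last d0 m0 mr.
by rewrite /= mem_block_last.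
Qed.

Lemma inflate_sorted d r : 0 < d -> all (fun m => 0 < m) r ->
  sorted ltn (inflate d r) -> sorted ltn r.
Proof.
move=> d0 r_pos; rewrite !(sorted_pairwise ltn_trans).
elim: r r_pos => //= m r IH /andP[m0 r_pos].
rewrite inflate_cons pairwise_cat => /and3P[/allrelP lt_m _ /(IH r_pos) ->]; rewrite andbT.
apply/allP => m' m'r /=; have m'0 := allP r_pos _ m'r.
have /= := lt_m _ _ (mem_block_last d0 m0) (mem_inflate_last d0 m'0 m'r).
by rewrite ltn_pmul2l.
Qed.

Lemma below_block d m m' e : 0 < m -> 0 < m' -> e < d ->
  below (block d m') ((d * m.-1).+1 + e) = (m' < m) * d + (m' == m) * e.
Proof.
move=> m0 m'0 lt_ed.
have countE a k i : count (fun y => y < i) (iota a k) = minn k (i - a).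
  elim: k a => [|k IH] a /=; first by rewrite min0n.
  by rewrite IH; lia.
rewrite /below /block countE.
case: m m0 => // m _; case: m' m'0 => // m' _ /=; rewrite ltnS eqSS.
case: (ltngtP m' m) => [lt_m|lt_m|->]; nia.
Qed.

(** Before the step e of the interval of m, each smaller label has contributed d
entries, and m itself e of them if it lies in the row. *)
Lemma below_inflate d r m e : all (fun x => 0 < x) r -> 0 < m -> e < d ->
  below (inflate d r) ((d * m.-1).+1 + e) = d * below r m + count_mem m r * e.
Proof.
move=> r_pos m0 lt_ed; elim: r r_pos => [|m' r IH] /=; first by rewrite muln0.
move=> /andP[m'0 r_pos]; rewrite inflate_cons /below count_cat -/(below _ _) -/(below _ _).
by rewrite below_block // IH //= -/(below r m); nia.
Qed.

(** * Comparing a tableau with its quotient *)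

Lemma sum_square_pairs R (G : nat -> nat -> nat) : (forall r, G r r = 0) ->
  \sum_(r' < R) \sum_(r < R) G r' r = \sum_(r < R) \sum_(r' < r) (G r' r + G r r').
Proof.
move=> G0; elim: R => [|R IH]; first by rewrite !big_ord0.
rewrite big_ord_recr [RHS]big_ord_recr /= big_ord_recr /= G0 addn0 -IH big_split /=.
under eq_bigr do rewrite big_ord_recr /=.
by rewrite big_split /= addnA.
Qed.

Lemma sum_minn n1 n2 (P : nat -> bool) :
  \sum_(k < n1) ((k < n2) && P k) = \sum_(k < minn n1 n2) P k.
Proof.
elim: n1 => [|n1 IH]; first by rewrite min0n !big_ord0.
rewrite big_ord_recr /= IH; have [lt12|le21] := ltnP n1 n2.
  have -> : minn n1.+1 n2 = n1.+1 by lia.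
  by rewrite big_ord_recr.
have -> : minn n1.+1 n2 = n2 by lia.
by rewrite addn0.
Qed.

Lemma eq_pair_min R len len' : (forall r, r < R -> len r = len' r) ->
  pair_min R len = pair_min R len'.
Proof.
move=> eq_len; apply: eq_bigr => r _; apply: eq_bigr => r' _.
by rewrite !eq_len // (ltn_trans (ltn_ord r')).
Qed.

Lemma pair_min_scale d R len : pair_min R (fun r => d * len r) = d * pair_min R len.
Proof.
rewrite /pair_min big_distrr; apply: eq_bigr => r _; rewrite big_distrr.
by apply: eq_bigr => r' _ /=; rewrite minnMr.
Qed.

(** Each pair of boxes in the same column is counted once, when the later of the two
is placed. *)
Lemma sum_below_rows q : uniq (flatten q) -> all (sorted ltn) q ->
  \sum_(r' < size q) \sum_(m <- nth [::] q r') \sum_(r < size q)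
     (below (nth [::] q r') m < below (nth [::] q r) m) =
  pair_min (size q) (fun r => size (nth [::] q r)).
Proof.
move=> q_uniq q_sorted; pose row r := nth [::] q r.
have r_sorted r : sorted ltn (row r) by apply: row_sorted.
pose G r' r := \sum_(m <- row r') (below (row r') m < below (row r) m).
transitivity (\sum_(r' < size q) \sum_(r < size q) G r' r).
  by apply: eq_bigr => r' _; rewrite exchange_big.
rewrite sum_square_pairs => [|r]; last by apply: big1 => m _; rewrite ltnn.
have GE r' r : G r' r = \sum_(k < minn (size (row r')) (size (row r)))
    (nth 0 (row r) k < nth 0 (row r') k).
  rewrite -(sum_minn _ _ (fun k => nth 0 (row r) k < nth 0 (row r') k)) /G (big_nth 0) big_mkord; apply: eq_bigr => k _.
  rewrite below_nth //; have [lt_k|le_k] := ltnP k (size (row r)).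
    by rewrite nth_lt_below.
  by rewrite ltnNge (leq_trans (below_leq_size _ _)).
apply: eq_bigr => r _; apply: eq_bigr => r' _.
rewrite !GE [minn (size (row r)) _]minnC -big_split /= -[RHS]muln1 -[X in X * 1](card_ord) -sum_nat_const.
apply: eq_bigr => k _; have lt_k := ltn_ord k; rewrite leq_min in lt_k.
have [lt_k' lt_k''] := andP lt_k.
suff : nth 0 (row r) k != nth 0 (row r') k by case: ltngtP.
apply: contraTneq (ltn_ord r') => e; rewrite -leqNgt.
rewrite (uniq_flatten_nth q_uniq (r := r') (r' := r) (x := nth 0 (row r) k)) //.
  by rewrite e mem_nth.
by rewrite mem_nth.
Qed.

(** Along the interval of m the rows are compared through d * A' + e + 1 and d * A,
where A' and A are their lengths in q just before m.  For e < d - 1 there is no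
tie and the outcome is A' < A; for e = d - 1 it is the comparison of A'.+1 with A
that defines the inversions of q. *)
Lemma num_springer_inversions_inflate d q : 0 < d ->
  all (fun m => 0 < m) (flatten q) -> uniq (flatten q) -> all (sorted ltn) q ->
  let s := [seq inflate d r | r <- q] in
  uniq (flatten s) -> all (sorted ltn) s ->
  num_springer_inversions s =
  d.-1 * pair_min (size q) (fun r => size (nth [::] q r)) + num_springer_inversions q.
Proof.
move=> d0 q_pos q_uniq q_sorted s s_uniq s_sorted.
have size_s : size s = size q by rewrite size_map.
have rowE r : r < size q -> nth [::] s r = inflate d (nth [::] q r).
  by move=> lt_r; rewrite (nth_map [::]).
have row_pos r : all (fun m => 0 < m) (nth [::] q r).
  have [lt_r|le_r] := ltnP r (size q); last by rewrite nth_default.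
  by apply/allP => m mr; apply: (allP q_pos); apply/flattenP; exists (nth [::] q r); rewrite ?mem_nth.
rewrite !num_springer_inversionsE // -sum_below_rows // size_s big_distrr -big_split /=.
apply: eq_bigr => r' _; rewrite rowE // /inflate big_flatten big_map big_distrr -big_split /=.
rewrite big_seq [RHS]big_seq; apply: eq_bigr => m mr'.
have m0 := allP (row_pos r') _ mr'.
rewrite exchange_big big_distrr -big_split /=; apply: eq_bigr => r _.
have sum_block (f : nat -> nat) :
    \sum_(i <- block d m) f i = \sum_(e < d) f ((d * m.-1).+1 + e).
  rewrite /block -[X in iota X _]addn0 iotaDl big_map.
  by rewrite -[X in iota _ X]subn0 -/(index_iota 0 d) big_mkord.
rewrite sum_block /ahead_after; have [<-|ner] := eqVneq r r'.
  by rewrite big1 => [|e _]; lia.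
have mNr : count_mem m (nth [::] q r) = 0.
  apply/count_memPn; apply: contra ner => mr.
  by apply/eqP/val_inj; apply: (uniq_flatten_nth q_uniq mr mr').
have mr'1 : count_mem m (nth [::] q r') = 1.
  by rewrite count_uniq_mem ?mr' // (sorted_uniq ltn_trans ltnn) // row_sorted.
set A := below (nth [::] q r) m; set A' := below (nth [::] q r') m.
transitivity (\sum_(e < d) (((d * A' + e).+1 < d * A) || ((d * A' + e).+1 == d * A) && (r < r'))).
  apply: eq_bigr => e _; rewrite !rowE // !below_inflate // mNr mr'1.
  by rewrite mul0n mul1n addn0.
case: d d0 {sum_block s_uniq s_sorted s size_s rowE} => // d' _; rewrite big_ord_recr /=; congr (_ + _).
  rewrite -[in RHS](card_ord d') -sum_nat_const; apply: eq_bigr => e _.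
  have lt_e := ltn_ord e; congr nat_of_bool.
  by have [lt_A|le_A] := ltnP A' A; nia.
congr nat_of_bool; have -> : (d'.+1 * A' + d').+1 = d'.+1 * A'.+1 by rewrite mulnS; lia.
by rewrite ltn_pmul2l // eqn_pmul2l.
Qed.

Lemma num_springer_inversions_quotient la s d :
  row_strict_tableau la s -> divisor d s ->
  num_springer_inversions s + pair_min (size (quotient_partition d la)) (nth 0 (quotient_partition d la)) =
  pair_min (size la) (nth 0 la) + num_springer_inversions (quotient_tableau d s).
Proof.
move=> /and3P[/eqP shape_s s_perm s_sorted] s_div; have [d0 _] := s_div.
have s_uniq : uniq (flatten s) by rewrite (perm_uniq s_perm) iota_uniq.
have [q sE q_pos] := divisor_inflate s_div s_perm.
have q_uniq : uniq (flatten q).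
  by apply: (inflate_uniq d0 q_pos); rewrite -inflate_flatten -sE.
have q_sorted : all (sorted ltn) q.
  apply/allP => r rq; apply: (inflate_sorted d0).
    by apply/allP => m mr; apply: (allP q_pos); apply/flattenP; exists r.
  by apply: (allP s_sorted); rewrite sE map_f.
have qE : quotient_tableau d s = q by rewrite sE quotient_inflate.
have size_la : size la = size q by rewrite -shape_s size_map sE size_map.
have laE r : r < size q -> nth 0 la r = d * size (nth [::] q r).
  by move=> lt_r; rewrite -shape_s /shape sE -map_comp (nth_map [::]) //= size_inflate.
rewrite qE size_map size_la (eq_pair_min laE) pair_min_scale.
rewrite (eq_pair_min (len' := fun r => size (nth [::] q r))) => [|r lt_r].
  rewrite sE num_springer_inversions_inflate -?sE //.
  by case: d d0 {s_div sE qE laE} => // d' _; rewrite /= mulSn; lia.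
by rewrite (nth_map 0) ?size_la // laE // mulKn.
Qed.

End Tableaux.

(** * The dimension formula *)

Theorem corollary5p7 (R : realType) (n : nat) (la : seq nat)
    (s : seq (seq nat)) (d : nat)
    (N : 'M[R[i]]_n) (N' : 'M[R[i]]_(n %/ d)) :
  is_partition n la ->
  row_strict_tableau la s ->
  divisor d s ->
  nilpotent_of_type la N ->
  nilpotent_of_type (quotient_partition d la) N' ->
  exists m m' : nat,
    [/\ has_dim (springer_fiber N) m,
        has_dim (springer_fiber N') m'
      & (num_springer_inversions s)%:Z
        = m%:Z - m'%:Z + (num_springer_inversions (quotient_tableau d s))%:Z].
Proof.
move=> la_part s_tab s_div N_la N'_la.
exists (pair_min (size la) (nth 0%N la)).
exists (pair_min (size (quotient_partition d la)) (nth 0%N (quotient_partition d la))).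
split; [exact: springer_fiber_dim | exact: springer_fiber_dim |].
by have := num_springer_inversions_quotient s_tab s_div; lia.
Qed.
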